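(* Consider the first integrals $$L=\omega r^2,\qquad E=\tfrac12v^2+\tfrac12L^2r^{-2}+U(r)-U(r_{\rm eq}),$$ $$\Theta=\theta-L\int_{r_0}^{r}\frac{\operatorname{sgn}(v)}{\sqrt{2(E+U(r_{\rm eq})-U(r))r^4-L^2r^2}}\,dr,\qquad T=t-\int_{r_0}^{r}\frac{\operatorname{sgn}(v)}{\sqrt{2(E+U(r_{\rm eq})-U(r))-L^2r^{-2}}}\,dr$$ of the polar equations of motion $\frac{d^2r}{dt^2}=\omega^2r-U'(r)$, $\frac{d^2\theta}{dt^2}=-2\omega v/r$ (with $v=dr/dt$, $\omega=d\theta/dt$), where $r_0$ is a turning point or an inertial point. The action of the infinitesimal point symmetries $\mathbf X_{(L)}=-\partial_\theta$, $\mathbf X_{(E)}=\partial_t$ on $L,E,\Theta,T$ consists of $$\operatorname{pr}\mathbf X_{(L)}(L)=\operatorname{pr}\mathbf X_{(L)}(E)=\operatorname{pr}\mathbf X_{(L)}(T)=0,\qquad \operatorname{pr}\mathbf X_{(L)}(\Theta)=-1,$$ $$\operatorname{pr}\mathbf X_{(E)}(L)=\operatorname{pr}\mathbf X_{(E)}(E)=\operatorname{pr}\mathbf X_{(E)}(\Theta)=0,\qquad \operatorname{pr}\mathbf X_{(E)}(T)=1,$$ and the action of the infinitesimal dynamical symmetries $\mathbf X_{(\Theta)}=\Theta_E\partial_t-\Theta_L\partial_\theta$ and $\mathbf X_{(T)}=T_E\partial_t-T_L\partial_\theta$ consists of $$\operatorname{pr}\mathbf X_{(\Theta)}(E)=\operatorname{pr}\mathbf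 X_{(\Theta)}(\Theta)=\operatorname{pr}\mathbf X_{(\Theta)}(T)=0,\qquad \operatorname{pr}\mathbf X_{(\Theta)}(L)=1,$$ $$\operatorname{pr}\mathbf X_{(T)}(L)=\operatorname{pr}\mathbf X_{(T)}(\Theta)=\operatorname{pr}\mathbf X_{(T)}(T)=0,\qquad \operatorname{pr}\mathbf X_{(T)}(E)=-1,$$ all prolongations being evaluated on solutions. Hence the four first integrals are canonical coordinates for these four infinitesimal symmetries.
   Context: The mass is $m=1$ and $U(r)$ is the radial potential of the central force. $r_{\rm eq}$ is an equilibrium point, $U'(r_{\rm eq})=0$ (which can include $r=0$ or $r=\infty$). With $U_{\rm eff}(r)=\tfrac12L^2r^{-2}+U(r)-U(r_{\rm eq})$, a turning point is a finite radial value $r_*$ with $U_{\rm eff}(r_* )=E$, and an inertial point is a finite radial value $r^*$ with $U_{\rm eff}'(r^* )=0$; $r_0$ is such a point on the trajectory. $L$ and $E$ are defined for all solutions, $\Theta$ and $T$ for all non-circular solutions ($r(t)$ not constant). $\Theta_L,\Theta_E,T_L,T_E$ denote partial derivatives of $\Theta$ and $T$ with respect to $L$ and $E$, where $L,E$ are in turn functions of $(r,v,\omega)$. For a generator $\mathbf X=\tau\partial_t+\xi\partial_r+\psi\partial_\theta$ with components depending on $(t,r,\theta,v,\omega)$, put $P^r=\xi-v\tau$, $P^\theta=\psi-\omega\tau$. Its prolongation evaluated on solutions is the vector field on $(t,r,\theta,v,\omega)$-space $$\operatorname{pr}\mathbf X=P^r\partial_r+P^\theta\partial_\theta+\frac{dP^r}{dt}\partial_v+\frac{dP^\theta}{dt}\partial_\omega+\tau\frac{d}{dt},$$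 where $\frac{d}{dt}=\partial_t+v\partial_r+\omega\partial_\theta+(\omega^2r-U'(r))\partial_v-(2\omega v/r)\partial_\omega$ is the total time derivative on solutions.
   Formalization: When r_0 is an inertial point it is held fixed as L and E vary; if it varies as r_0(L), then pr X_(Θ)(T) = Θ_E + T_L ≠ 0 (e.g. U = r²/2, r_0 = √L, E > L > 0). U is taken smooth on r > 0 and the identities hold at states with v ≠ 0. *)

(* Defs.v *)
(* Planar central-force dynamics with unit mass, over Stdlib reals with Coquelicot.
   The radius ranges over r > 0; the value of a potential at r <= 0 is irrelevant. *)
From Stdlib Require Import Reals.
From Coquelicot Require Import Coquelicot.
Open Scope R_scope.

Definition smooth_potential (U : R -> R) : Prop :=
  forall (n : nat) (r : R), 0 < r -> ex_derive_n U n r.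

(* [equilibrium U req u]: U'(req) = 0 and u is the value U(req), both understood
   as limits when req is 0 or infinity. *)
Inductive equilibrium (U : R -> R) : Rbar -> R -> Prop :=
| equilibrium_interior : forall r : R,
    0 < r -> Derive U r = 0 -> equilibrium U (Finite r) (U r)
| equilibrium_origin : forall u : R,
    filterlim U (at_right 0) (locally u) ->
    filterlim (Derive U) (at_right 0) (locally 0) ->
    equilibrium U (Finite 0) u
| equilibrium_infinity : forall u : R,
    is_lim U p_infty (Finite u) ->
    is_lim (Derive U) p_infty (Finite 0) ->
    equilibrium U p_infty u.

(* In what follows ueq stands for U(r_eq). *)
Definition Ueff (U : R -> R) (ueq L r : R) : R :=
  / 2 * L ^ 2 / r ^ 2 + U r - ueq.

Definition turning_point (U : R -> R) (ueq L E rs : R) : Prop :=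
  0 < rs /\ Ueff U ueq L rs = E.

Definition inertial_point (U : R -> R) (ueq L rs : R) : Prop :=
  0 < rs /\ Derive (Ueff U ueq L) rs = 0.

(* The arguments of a phase function are t, r, theta, v, omega, in this order. *)
Definition phase_fun : Type := R -> R -> R -> R -> R -> R.

Definition d_t (F : phase_fun) : phase_fun :=
  fun t r th v om => Derive (fun x => F x r th v om) t.
Definition d_r (F : phase_fun) : phase_fun :=
  fun t r th v om => Derive (fun x => F t x th v om) r.
Definition d_th (F : phase_fun) : phase_fun :=
  fun t r th v om => Derive (fun x => F t r x v om) th.
Definition d_v (F : phase_fun) : phase_fun :=
  fun t r th v om => Derive (fun x => F t r th x om) v.
Definition d_om (F : phase_fun) : phase_fun :=
  fun t r th v om => Derive (fun x => F t r th v x) om.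

Definition has_partials (F : phase_fun) (t r th v om : R) : Prop :=
  ex_derive (fun x => F x r th v om) t /\
  ex_derive (fun x => F t x th v om) r /\
  ex_derive (fun x => F t r x v om) th /\
  ex_derive (fun x => F t r th x om) v /\
  ex_derive (fun x => F t r th v x) om.

(* Total time derivative on solutions. *)
Definition Dt (U : R -> R) (F : phase_fun) : phase_fun :=
  fun t r th v om =>
    d_t F t r th v om + v * d_r F t r th v om + om * d_th F t r th v om
    + (om ^ 2 * r - Derive U r) * d_v F t r th v om
    - 2 * om * v / r * d_om F t r th v om.

(* The generator tau d/dt + xi d/dr + psi d/dtheta. *)
Record generator : Type :=
  Generator { tau : phase_fun; xi : phase_fun; psi : phase_fun }.

Definition char_r (X : generator) : phase_fun :=
  fun t r th v om => xi X t r th v om - v * tau X t r th v om.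
Definition char_th (X : generator) : phase_fun :=
  fun t r th v om => psi X t r th v om - om * tau X t r th v om.

(* Prolongation evaluated on solutions. *)
Definition pr (U : R -> R) (X : generator) (F : phase_fun) : phase_fun :=
  fun t r th v om =>
    char_r X t r th v om * d_r F t r th v om
    + char_th X t r th v om * d_th F t r th v om
    + Dt U (char_r X) t r th v om * d_v F t r th v om
    + Dt U (char_th X) t r th v om * d_om F t r th v om
    + tau X t r th v om * Dt U F t r th v om.

(* [pr U X F = c] at a state, together with the existence of every partial
   derivative involved ([Derive] being total). *)
Definition pr_acts (U : R -> R) (X : generator) (F : phase_fun) (c : R)
    (t r th v om : R) : Prop :=
  has_partials (char_r X) t r th v om /\
  has_partials (char_th X) t r th v om /\
  has_partials F t r th v om /\
  pr U X F t r th v om = c.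

Definition first_integral_at (U : R -> R) (F : phase_fun) (t r th v om : R) : Prop :=
  has_partials F t r th v om /\ Dt U F t r th v om = 0.

Definition functionally_independent (F1 F2 F3 F4 : phase_fun) (t r th v om : R) : Prop :=
  forall c1 c2 c3 c4 : R,
    let comb (D : phase_fun -> phase_fun) : R :=
      c1 * D F1 t r th v om + c2 * D F2 t r th v om
      + c3 * D F3 t r th v om + c4 * D F4 t r th v om in
    comb d_t = 0 -> comb d_r = 0 -> comb d_th = 0 -> comb d_v = 0 -> comb d_om = 0 ->
    c1 = 0 /\ c2 = 0 /\ c3 = 0 /\ c4 = 0.

Definition fi_L : phase_fun := fun t r th v om => om * r ^ 2.

Definition fi_E (U : R -> R) (ueq : R) : phase_fun :=
  fun t r th v om =>
    / 2 * v ^ 2 + / 2 * (fi_L t r th v om) ^ 2 / r ^ 2 + U r - ueq.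

(* The oriented integral of f from a to b, improper at a: the integrands below
   are unbounded at a turning point. *)
Definition end_filter (a b : R) : (R -> Prop) -> Prop :=
  if Rlt_dec a b then at_right a else at_left a.
Definition radial_int (f : R -> R) (a b : R) : R :=
  RInt_gen f (end_filter a b) (at_point b).
Definition ex_radial_int (f : R -> R) (a b : R) : Prop :=
  ex_RInt_gen f (end_filter a b) (at_point b).

(* sg is sgn(v). *)
Definition Theta_integrand (U : R -> R) (ueq sg L E : R) : R -> R :=
  fun x => sg / sqrt (2 * (E + ueq - U x) * x ^ 4 - L ^ 2 * x ^ 2).
Definition T_integrand (U : R -> R) (ueq sg L E : R) : R -> R :=
  fun x => sg / sqrt (2 * (E + ueq - U x) - L ^ 2 / x ^ 2).

(* Theta and T in the coordinates (t, r, theta, L, E), on the sheet of phase space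
   where sgn(v) = sg. The base point r_0 is a function of (L, E). *)
Definition Theta_LE (U : R -> R) (ueq : R) (r0 : R -> R -> R) (sg r th L E : R) : R :=
  th - L * radial_int (Theta_integrand U ueq sg L E) (r0 L E) r.
Definition T_LE (U : R -> R) (ueq : R) (r0 : R -> R -> R) (sg t r L E : R) : R :=
  t - radial_int (T_integrand U ueq sg L E) (r0 L E) r.

Section FirstIntegrals.

Variables (U : R -> R) (ueq : R) (r0 : R -> R -> R).

Definition fi_Theta : phase_fun := fun t r th v om =>
  Theta_LE U ueq r0 (sign v) r th (fi_L t r th v om) (fi_E U ueq t r th v om).
Definition fi_T : phase_fun := fun t r th v om =>
  T_LE U ueq r0 (sign v) t r (fi_L t r th v om) (fi_E U ueq t r th v om).

(* Partial derivatives with respect to L and E at fixed (t, r, theta), then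
   regarded as functions on phase space. *)
Definition Theta_L : phase_fun := fun t r th v om =>
  Derive (fun l => Theta_LE U ueq r0 (sign v) r th l (fi_E U ueq t r th v om))
    (fi_L t r th v om).
Definition Theta_E : phase_fun := fun t r th v om =>
  Derive (fun e => Theta_LE U ueq r0 (sign v) r th (fi_L t r th v om) e)
    (fi_E U ueq t r th v om).
Definition T_L : phase_fun := fun t r th v om =>
  Derive (fun l => T_LE U ueq r0 (sign v) t r l (fi_E U ueq t r th v om))
    (fi_L t r th v om).
Definition T_E : phase_fun := fun t r th v om =>
  Derive (fun e => T_LE U ueq r0 (sign v) t r (fi_L t r th v om) e)
    (fi_E U ueq t r th v om).

Definition Theta_T_well_defined (t r th v om : R) : Prop :=
  let L := fi_L t r th v om in
  let E := fi_E U ueq t r th v om in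
  ex_radial_int (Theta_integrand U ueq (sign v) L E) (r0 L E) r /\
  ex_radial_int (T_integrand U ueq (sign v) L E) (r0 L E) r /\
  ex_derive (fun l => Theta_LE U ueq r0 (sign v) r th l E) L /\
  ex_derive (fun e => Theta_LE U ueq r0 (sign v) r th L e) E /\
  ex_derive (fun l => T_LE U ueq r0 (sign v) t r l E) L /\
  ex_derive (fun e => T_LE U ueq r0 (sign v) t r L e) E.

Definition cst (c : R) : phase_fun := fun t r th v om => c.

Definition X_L : generator := Generator (cst 0) (cst 0) (cst (- 1)).
Definition X_E : generator := Generator (cst 1) (cst 0) (cst 0).
Definition X_Theta : generator :=
  Generator Theta_E (cst 0) (fun t r th v om => - Theta_L t r th v om).
Definition X_T : generator :=
  Generator T_E (cst 0) (fun t r th v om => - T_L t r th v om).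

Definition is_solution (a b : R) (rad ang vel avel : R -> R) : Prop :=
  forall s : R, a < s < b ->
    0 < rad s /\
    is_derive rad s (vel s) /\
    is_derive ang s (avel s) /\
    is_derive vel s ((avel s) ^ 2 * rad s - Derive U (rad s)) /\
    is_derive avel s (- (2 * avel s * vel s / rad s)).

Definition on_trajectory (t r th v om rho : R) : Prop :=
  exists (a b : R) (rad ang vel avel : R -> R),
    a < t < b /\ is_solution a b rad ang vel avel /\
    rad t = r /\ ang t = th /\ vel t = v /\ avel t = om /\
    exists s : R, a < s < b /\ rad s = rho.

(* The admissible base points at a state. A turning point is a continuous branch
   r_0(L, E) of turning points of the neighbouring trajectories. An inertial point
   of the trajectory is kept as a fixed lower limit when L and E vary: along a
   branch r_0(L) of inertial points one has Theta_E + T_L = r_0'(L) / v(r_0), with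
   v(r_0) the radial velocity there, whereas pr X_Theta (T) = Theta_E + T_L has to
   vanish. *)
Definition turning_base_point (t r th v om : R) : Prop :=
  let L := fi_L t r th v om in
  let E := fi_E U ueq t r th v om in
  locally_2d (fun l e => turning_point U ueq l e (r0 l e)) L E /\
  continuity_2d_pt r0 L E.

Definition inertial_base_point (t r th v om : R) : Prop :=
  let L := fi_L t r th v om in
  let E := fi_E U ueq t r th v om in
  inertial_point U ueq L (r0 L E) /\
  locally_2d (fun l e => r0 l e = r0 L E) L E.

Definition base_point (t r th v om : R) : Prop :=
  on_trajectory t r th v om (r0 (fi_L t r th v om) (fi_E U ueq t r th v om)) /\
  (turning_base_point t r th v om \/ inertial_base_point t r th v om).

End FirstIntegrals.

(* Main.v *)
Require Import Defs.
From Stdlib Require Import Reals Lra Psatz ClassicalEpsilon Ranalysis5.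
From Coquelicot Require Import Coquelicot.
Open Scope R_scope.

(* The radial integrals are handled through the radial action
     W(r, lam, E) = int_{r_0}^{r} sqrt(g),   g = 2 (E + U(r_eq) - U) - lam / r^2,   lam = L^2,
   since formally int dr / sqrt(g) = W_E and int dr / (r^2 sqrt(g)) = - 2 W_lam, so that
   Theta = theta + sgn(v) W_L and T = t - sgn(v) W_E.  At a turning point the integrand of
   W_E blows up; but uniqueness of solutions makes the zero of g simple there, so
   integrating by parts turns sqrt(g) into g^(7/2) times a smooth function.  The latter
   integral may be started at a fixed point beyond the turning point (g_+^(7/2) vanishes
   up to it), which shows that W is C^3 where g > 0 and that W_E and W_L vanish at the
   turning point.  At an inertial point g > 0 and no such care is needed.  Everything
   else follows from the symmetry of the mixed derivatives of W and from
   W_r = sqrt(g) = |v|. *)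

(** * Functions of class C^k of three real variables *)

(** Three derivatives of the action are required because the components of [X_Theta] and [X_T] are
    already second derivatives of it in (L, E), and prolonging them differentiates once more along
    the motion. This fixes the exponent 7/2: the positive part of y^(7/2) is C^3 on the whole line.
    A turning point moves with (L, E), but its branch r_0(L, E) is only assumed continuous, so
    nothing may be obtained by differentiating a lower limit. A fixed starting point removes the
    moving limit, and the branch enters only as the place where W_E and W_L vanish. The construction
    near a turning point relies on a constant sign of g', hence on a small box. It is continued up
    to r, where only g > 0 is known, by an ordinary integral of sqrt(g). That g > 0 between r_0 and
    r comes from the trajectory: an interior zero would be a minimum of g, hence double. The action
    is never computed explicitly. Since L and E are conserved, total time derivatives see only the
    radial derivatives of its parameter derivatives, and W_r = sqrt(g) gives those in closed
    form. *)

Lemma is_derive_plus_R (f g : R -> R) (x df dg : R) :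
  is_derive f x df -> is_derive g x dg -> is_derive (fun u => f u + g u) x (df + dg).
Proof. exact (is_derive_plus f g x df dg). Qed.

Lemma is_derive_mult_R (f g : R -> R) (x df dg : R) :
  is_derive f x df -> is_derive g x dg ->
  is_derive (fun u => f u * g u) x (df * g x + f x * dg).
Proof. intros Hf Hg. apply (is_derive_mult f g x df dg Hf Hg Rmult_comm). Qed.

Lemma is_derive_comp_R (f g : R -> R) (x df dg : R) :
  is_derive f (g x) df -> is_derive g x dg ->
  is_derive (fun u => f (g u)) x (df * dg).
Proof.
  intros Hf Hg. rewrite Rmult_comm. exact (is_derive_comp f g x df dg Hf Hg).
Qed.

Lemma is_derive_const_R (c x : R) : is_derive (fun _ : R => c) x 0.
Proof. exact (is_derive_const c x). Qed.

Lemma is_derive_ext_R (f g : R -> R) (x l : R) :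
  (forall u, f u = g u) -> is_derive f x l -> is_derive g x l.
Proof. exact (is_derive_ext f g x l). Qed.

Lemma is_derive_eq (f : R -> R) (x l l' : R) : is_derive f x l -> l = l' -> is_derive f x l'.
Proof. now intros H <-. Qed.

Definition D1 (f : R -> R -> R -> R) (x y z : R) : R := Derive (fun u => f u y z) x.
Definition D2 (f : R -> R -> R -> R) (x y z : R) : R := Derive (fun u => f x u z) y.
Definition D3 (f : R -> R -> R -> R) (x y z : R) : R := Derive (fun u => f x y u) z.

Definition cont3 (f : R -> R -> R -> R) (x y z : R) : Prop :=
  continuous (fun p : R * R * R => f (fst (fst p)) (snd (fst p)) (snd p)) (x, y, z).

Lemma cont3_spec (f : R -> R -> R -> R) (x y z : R) :
  cont3 f x y z <->
  forall eps : posreal, exists d : posreal, forall x' y' z',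
    Rabs (x' - x) < d -> Rabs (y' - y) < d -> Rabs (z' - z) < d ->
    Rabs (f x' y' z' - f x y z) < eps.
Proof.
  unfold cont3, continuous. rewrite filterlim_locally. split.
  - intros H eps. destruct (H eps) as [d Hd]. exists d. intros x' y' z' H1 H2 H3.
    apply (Hd (x', y', z')). repeat split; assumption.
  - intros H eps. destruct (H eps) as [d Hd]. exists d.
    intros [[x' y'] z'] [[H1 H2] H3]. apply Hd; assumption.
Qed.

Lemma cont3_const (c x y z : R) : cont3 (fun _ _ _ => c) x y z.
Proof. apply continuous_const. Qed.

Lemma cont3_plus (f g : R -> R -> R -> R) (x y z : R) :
  cont3 f x y z -> cont3 g x y z -> cont3 (fun a b c => f a b c + g a b c) x y z.
Proof. intros Hf Hg. exact (continuous_plus _ _ _ Hf Hg). Qed.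

Lemma cont3_mult (f g : R -> R -> R -> R) (x y z : R) :
  cont3 f x y z -> cont3 g x y z -> cont3 (fun a b c => f a b c * g a b c) x y z.
Proof. intros Hf Hg. exact (continuous_mult _ _ _ Hf Hg). Qed.

Lemma cont3_comp (h : R -> R) (f : R -> R -> R -> R) (x y z : R) :
  cont3 f x y z -> continuous h (f x y z) -> cont3 (fun a b c => h (f a b c)) x y z.
Proof.
  intros Hf Hh.
  apply (continuous_comp (fun p : R * R * R => f (fst (fst p)) (snd (fst p)) (snd p)) h _ Hf).
  exact Hh.
Qed.

Lemma cont3_coord1 (h : R -> R) (x y z : R) :
  continuous h x -> cont3 (fun a _ _ => h a) x y z.
Proof.
  intros Hh.
  apply (continuous_comp (fun p : R * R * R => fst (fst p)) h); [|exact Hh].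
  apply (continuous_comp (fun p : R * R * R => fst p) fst); apply continuous_fst.
Qed.

Lemma cont3_coord2 (h : R -> R) (x y z : R) :
  continuous h y -> cont3 (fun _ b _ => h b) x y z.
Proof.
  intros Hh.
  apply (continuous_comp (fun p : R * R * R => snd (fst p)) h); [|exact Hh].
  apply (continuous_comp (fun p : R * R * R => fst p) snd);
    [apply continuous_fst | apply continuous_snd].
Qed.

Lemma cont3_coord3 (h : R -> R) (x y z : R) :
  continuous h z -> cont3 (fun _ _ c => h c) x y z.
Proof.
  intros Hh.
  apply (continuous_comp (fun p : R * R * R => snd p) h); [|exact Hh].
  apply continuous_snd.
Qed.

Lemma cont3_comp3 (f a b c : R -> R -> R -> R) (x y z : R) :
  cont3 f (a x y z) (b x y z) (c x y z) ->
  cont3 a x y z -> cont3 b x y z -> cont3 c x y z ->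
  cont3 (fun u v w => f (a u v w) (b u v w) (c u v w)) x y z.
Proof.
  rewrite !cont3_spec. intros Hf Ha Hb Hc eps.
  destruct (Hf eps) as [d Hd].
  destruct (Ha d) as [da Hda], (Hb d) as [db Hdb], (Hc d) as [dc Hdc].
  exists (mkposreal _ (Rmin_stable_in_posreal da (mkposreal _ (Rmin_stable_in_posreal db dc)))).
  simpl. intros x' y' z' H1 H2 H3.
  assert (forall u, u < Rmin da (Rmin db dc) -> u < da /\ u < db /\ u < dc) as Hm.
  { intros u Hu. generalize (Rmin_l da (Rmin db dc)) (Rmin_r da (Rmin db dc))
      (Rmin_l db dc) (Rmin_r db dc). lra. }
  apply Hm in H1. apply Hm in H2. apply Hm in H3.
  apply Hd; [apply Hda | apply Hdb | apply Hdc]; tauto.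
Qed.

(** [Derive] is total, so existence of the partial derivatives is recorded separately at every
    order. At a single point this is weaker than the usual notion; it becomes C^k when it is
    required throughout an open region, as in [CkOn]. *)
Fixpoint Ck (k : nat) (f : R -> R -> R -> R) (x y z : R) : Prop :=
  cont3 f x y z /\
  match k with
  | O => True
  | S k' =>
      (ex_derive (fun u => f u y z) x /\ ex_derive (fun u => f x u z) y /\
       ex_derive (fun u => f x y u) z) /\
      (Ck k' (D1 f) x y z /\ Ck k' (D2 f) x y z /\ Ck k' (D3 f) x y z)
  end.

Definition region : Type := R -> R -> R -> Prop.

Definition open3 (D : region) : Prop :=
  forall x y z, D x y z -> exists d : posreal, forall x' y' z',
    Rabs (x' - x) < d -> Rabs (y' - y) < d -> Rabs (z' - z) < d -> D x' y' z'.

Definition CkOn (k : nat) (D : region) (f : R -> R -> R -> R) : Prop :=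
  forall x y z, D x y z -> Ck k f x y z.

Lemma open3_lines (D : region) (x y z : R) : open3 D -> D x y z ->
  locally x (fun u => D u y z) /\ locally y (fun u => D x u z) /\ locally z (fun u => D x y u).
Proof.
  intros HD Hp. destruct (HD _ _ _ Hp) as [d Hd].
  assert (H0 : forall u : R, Rabs (u - u) < d).
  { intros u. rewrite Rminus_eq_0, Rabs_R0. apply cond_pos. }
  repeat split; exists d; intros u Hu; apply Hd; auto.
Qed.

Lemma cont3_ext (D : region) (f g : R -> R -> R -> R) (x y z : R) :
  open3 D -> D x y z -> (forall a b c, D a b c -> f a b c = g a b c) ->
  cont3 f x y z -> cont3 g x y z.
Proof.
  intros HD Hp Hfg. rewrite !cont3_spec. intros Hf eps.
  destruct (Hf eps) as [d Hd], (HD _ _ _ Hp) as [d' Hd'].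
  exists (mkposreal _ (Rmin_stable_in_posreal d d')). simpl. intros x' y' z' H1 H2 H3.
  generalize (Rmin_l d d') (Rmin_r d d'). intros M1 M2.
  rewrite <- !Hfg; [apply Hd | | apply Hd']; auto; lra.
Qed.

Lemma D_ext (D : region) (f g : R -> R -> R -> R) (x y z : R) :
  open3 D -> D x y z -> (forall a b c, D a b c -> f a b c = g a b c) ->
  D1 f x y z = D1 g x y z /\ D2 f x y z = D2 g x y z /\ D3 f x y z = D3 g x y z.
Proof.
  intros HD Hp Hfg. destruct (open3_lines D x y z HD Hp) as (H1 & H2 & H3).
  repeat split; apply Derive_ext_loc.
  - revert H1. apply filter_imp. auto.
  - revert H2. apply filter_imp. auto.
  - revert H3. apply filter_imp. auto.
Qed.

Lemma CkOn_ext (k : nat) (D : region) (f g : R -> R -> R -> R) :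
  open3 D -> (forall a b c, D a b c -> f a b c = g a b c) -> CkOn k D f -> CkOn k D g.
Proof.
  intros HD. revert f g. induction k as [|k IH]; intros f g Hfg Hf x y z Hp.
  - split; [|exact I]. apply (cont3_ext D f g); auto. apply (Hf _ _ _ Hp).
  - destruct (Hf _ _ _ Hp) as (Hc & (E1 & E2 & E3) & (C1 & C2 & C3)).
    destruct (open3_lines D x y z HD Hp) as (L1 & L2 & L3).
    split; [apply (cont3_ext D f g); auto | split].
    + repeat split; [revert E1 | revert E2 | revert E3]; apply ex_derive_ext_loc;
        [revert L1 | revert L2 | revert L3]; apply filter_imp; auto.
    + repeat split; [apply (IH (D1 f)) | apply (IH (D2 f)) | apply (IH (D3 f))]; auto;
        try (intros a b c Ha; apply (D_ext D f g a b c HD Ha Hfg));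
        intros a b c Ha; apply (Hf a b c Ha).
Qed.

(** Introduction rule behind the closure properties below: formulas for the partial derivatives that
    are valid only on [D] replace the [Derive] terms, which openness of [D] permits. *)
Lemma CkOn_S (k : nat) (D : region) (f f1 f2 f3 : R -> R -> R -> R) :
  open3 D ->
  (forall x y z, D x y z -> cont3 f x y z) ->
  (forall x y z, D x y z -> is_derive (fun u => f u y z) x (f1 x y z)) ->
  (forall x y z, D x y z -> is_derive (fun u => f x u z) y (f2 x y z)) ->
  (forall x y z, D x y z -> is_derive (fun u => f x y u) z (f3 x y z)) ->
  CkOn k D f1 -> CkOn k D f2 -> CkOn k D f3 -> CkOn (S k) D f.
Proof.
  intros HD Hc H1 H2 H3 C1 C2 C3 x y z Hp. split; [auto | split].
  - repeat split; eexists; eauto.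
  - repeat split.
    + apply (CkOn_ext k D f1); auto. intros a b c Ha. symmetry.
      apply is_derive_unique, H1, Ha.
    + apply (CkOn_ext k D f2); auto. intros a b c Ha. symmetry.
      apply is_derive_unique, H2, Ha.
    + apply (CkOn_ext k D f3); auto. intros a b c Ha. symmetry.
      apply is_derive_unique, H3, Ha.
Qed.

Section CkFacts.

Variables (k : nat) (D : region) (f : R -> R -> R -> R).

Lemma CkOn_cont : CkOn k D f -> forall x y z, D x y z -> cont3 f x y z.
Proof. intros H x y z Hp. specialize (H x y z Hp). destruct k; apply H. Qed.

Hypothesis Hf : CkOn (S k) D f.

Lemma CkOn_is_derive1 (x y z : R) : D x y z -> is_derive (fun u => f u y z) x (D1 f x y z).
Proof. intros Hp. apply Derive_correct. apply (Hf x y z Hp). Qed.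

Lemma CkOn_is_derive2 (x y z : R) : D x y z -> is_derive (fun u => f x u z) y (D2 f x y z).
Proof. intros Hp. apply Derive_correct. apply (Hf x y z Hp). Qed.

Lemma CkOn_is_derive3 (x y z : R) : D x y z -> is_derive (fun u => f x y u) z (D3 f x y z).
Proof. intros Hp. apply Derive_correct. apply (Hf x y z Hp). Qed.

Lemma CkOn_D1 : CkOn k D (D1 f).
Proof. intros x y z Hp. apply (Hf x y z Hp). Qed.

Lemma CkOn_D2 : CkOn k D (D2 f).
Proof. intros x y z Hp. apply (Hf x y z Hp). Qed.

Lemma CkOn_D3 : CkOn k D (D3 f).
Proof. intros x y z Hp. apply (Hf x y z Hp). Qed.

End CkFacts.

Lemma CkOn_pred (k : nat) (D : region) (f : R -> R -> R -> R) : CkOn (S k) D f -> CkOn k D f.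
Proof.
  revert f. induction k as [|k IH]; intros f Hf x y z Hp.
  - split; [apply (Hf x y z Hp) | exact I].
  - destruct (Hf x y z Hp) as (Hc & He & _). split; [exact Hc | split; [exact He |]].
    repeat split.
    + apply (IH (D1 f)); auto. apply CkOn_D1, Hf.
    + apply (IH (D2 f)); auto. apply CkOn_D2, Hf.
    + apply (IH (D3 f)); auto. apply CkOn_D3, Hf.
Qed.

Lemma CkOn_sub (k : nat) (D D' : region) (f : R -> R -> R -> R) :
  (forall x y z, D' x y z -> D x y z) -> CkOn k D f -> CkOn k D' f.
Proof. intros H Hf x y z Hp. apply Hf, H, Hp. Qed.

Lemma CkOn_const (k : nat) (D : region) (c : R) : open3 D -> CkOn k D (fun _ _ _ => c).
Proof.
  intros HD. revert c. induction k as [|k IH]; intros c.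
  - intros x y z _. split; [apply cont3_const | exact I].
  - apply (CkOn_S k D _ (fun _ _ _ => 0) (fun _ _ _ => 0) (fun _ _ _ => 0)); auto;
      intros; solve [apply is_derive_const_R | apply cont3_const | apply IH].
Qed.

Lemma CkOn_plus (k : nat) (D : region) (f g : R -> R -> R -> R) :
  open3 D -> CkOn k D f -> CkOn k D g -> CkOn k D (fun x y z => f x y z + g x y z).
Proof.
  intros HD. revert f g. induction k as [|k IH]; intros f g Hf Hg.
  - intros x y z Hp. split; [|exact I].
    apply cont3_plus; [apply (Hf x y z Hp) | apply (Hg x y z Hp)].
  - apply (CkOn_S k D _ (fun x y z => D1 f x y z + D1 g x y z)
      (fun x y z => D2 f x y z + D2 g x y z) (fun x y z => D3 f x y z + D3 g x y z) HD).
    + intros x y z Hp. apply cont3_plus; eapply CkOn_cont; eauto.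
    + intros x y z Hp. apply is_derive_plus_R; eapply CkOn_is_derive1; eauto.
    + intros x y z Hp. apply is_derive_plus_R; eapply CkOn_is_derive2; eauto.
    + intros x y z Hp. apply is_derive_plus_R; eapply CkOn_is_derive3; eauto.
    + apply IH; now apply CkOn_D1.
    + apply IH; now apply CkOn_D2.
    + apply IH; now apply CkOn_D3.
Qed.

Lemma CkOn_mult (k : nat) (D : region) (f g : R -> R -> R -> R) :
  open3 D -> CkOn k D f -> CkOn k D g -> CkOn k D (fun x y z => f x y z * g x y z).
Proof.
  intros HD. revert f g. induction k as [|k IH]; intros f g Hf Hg.
  - intros x y z Hp. split; [|exact I].
    apply cont3_mult; [apply (Hf x y z Hp) | apply (Hg x y z Hp)].
  - assert (Hf' := CkOn_pred _ _ _ Hf). assert (Hg' := CkOn_pred _ _ _ Hg).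
    apply (CkOn_S k D _ (fun x y z => D1 f x y z * g x y z + f x y z * D1 g x y z)
      (fun x y z => D2 f x y z * g x y z + f x y z * D2 g x y z)
      (fun x y z => D3 f x y z * g x y z + f x y z * D3 g x y z) HD).
    + intros x y z Hp. apply cont3_mult; eapply CkOn_cont; eauto.
    + intros x y z Hp.
      apply (is_derive_mult_R (fun u => f u y z) (fun u => g u y z));
        eapply CkOn_is_derive1; eauto.
    + intros x y z Hp.
      apply (is_derive_mult_R (fun u => f x u z) (fun u => g x u z));
        eapply CkOn_is_derive2; eauto.
    + intros x y z Hp.
      apply (is_derive_mult_R (fun u => f x y u) (fun u => g x y u));
        eapply CkOn_is_derive3; eauto.
    + apply CkOn_plus; auto; apply IH; auto; now apply CkOn_D1.
    + apply CkOn_plus; auto; apply IH; auto; now apply CkOn_D2.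
    + apply CkOn_plus; auto; apply IH; auto; now apply CkOn_D3.
Qed.

(** Only one order is gained at a time, with [dh] composed with [f] left as an obligation. This
    suits outer functions whose derivative is an expression in themselves, such as the inverse, the
    square root and the half powers: induction on [k] then closes. *)
Lemma CkOn_comp_S (k : nat) (D : region) (h dh : R -> R) (f : R -> R -> R -> R) :
  open3 D ->
  (forall x y z, D x y z -> is_derive h (f x y z) (dh (f x y z))) ->
  CkOn (S k) D f -> CkOn k D (fun x y z => dh (f x y z)) ->
  CkOn (S k) D (fun x y z => h (f x y z)).
Proof.
  intros HD Hh Hf Hdh.
  apply (CkOn_S k D _ (fun x y z => dh (f x y z) * D1 f x y z)
      (fun x y z => dh (f x y z) * D2 f x y z) (fun x y z => dh (f x y z) * D3 f x y z) HD).
  - intros x y z Hp. apply cont3_comp; [eapply CkOn_cont; eauto |].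
    apply (ex_derive_continuous h). eexists. eauto.
  - intros x y z Hp. apply (is_derive_comp_R h (fun u => f u y z)); auto.
    eapply CkOn_is_derive1; eauto.
  - intros x y z Hp. apply (is_derive_comp_R h (fun u => f x u z)); auto.
    eapply CkOn_is_derive2; eauto.
  - intros x y z Hp. apply (is_derive_comp_R h (fun u => f x y u)); auto.
    eapply CkOn_is_derive3; eauto.
  - apply CkOn_mult; auto. now apply CkOn_D1.
  - apply CkOn_mult; auto. now apply CkOn_D2.
  - apply CkOn_mult; auto. now apply CkOn_D3.
Qed.

Lemma CkOn_scal (k : nat) (D : region) (c : R) (f : R -> R -> R -> R) :
  open3 D -> CkOn k D f -> CkOn k D (fun x y z => c * f x y z).
Proof. intros HD Hf. apply CkOn_mult; auto. now apply CkOn_const. Qed.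

Lemma CkOn_inv (k : nat) (D : region) (f : R -> R -> R -> R) :
  open3 D -> (forall x y z, D x y z -> f x y z <> 0) ->
  CkOn k D f -> CkOn k D (fun x y z => / f x y z).
Proof.
  intros HD Hn. induction k as [|k IH]; intros Hf.
  - intros x y z Hp. split; [|exact I]. apply cont3_comp; [apply (Hf x y z Hp) |].
    apply continuous_Rinv, Hn, Hp.
  - apply (CkOn_comp_S k D Rinv (fun u => (- 1) * (/ u * / u))); auto.
    + intros x y z Hp. specialize (Hn x y z Hp). auto_derive; auto. field. auto.
    + assert (Hf' := CkOn_pred _ _ _ Hf).
      apply CkOn_scal; auto. apply CkOn_mult; auto.
Qed.

Lemma CkOn_sqrt (k : nat) (D : region) (f : R -> R -> R -> R) :
  open3 D -> (forall x y z, D x y z -> 0 < f x y z) ->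
  CkOn k D f -> CkOn k D (fun x y z => sqrt (f x y z)).
Proof.
  intros HD Hn. induction k as [|k IH]; intros Hf.
  - intros x y z Hp. split; [|exact I]. apply cont3_comp; [apply (Hf x y z Hp) |].
    apply continuous_sqrt.
  - apply (CkOn_comp_S k D sqrt (fun u => / 2 * / sqrt u)); auto.
    + intros x y z Hp. specialize (Hn x y z Hp). auto_derive; auto. field.
      apply Rgt_not_eq, sqrt_lt_R0, Hn.
    + assert (Hf' := CkOn_pred _ _ _ Hf).
      apply CkOn_scal; auto. apply CkOn_inv; auto.
      intros x y z Hp. apply Rgt_not_eq, sqrt_lt_R0, Hn, Hp.
Qed.

Lemma CkOn_coord1 (k : nat) (D : region) : open3 D -> CkOn k D (fun x _ _ => x).
Proof.
  intros HD. destruct k as [|k].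
  - intros x y z _. split; [|exact I]. apply (cont3_coord1 (fun u => u)), continuous_id.
  - apply (CkOn_S k D _ (fun _ _ _ => 1) (fun _ _ _ => 0) (fun _ _ _ => 0)); auto;
      try (now apply CkOn_const); intros; try apply is_derive_const_R.
    + apply (cont3_coord1 (fun u => u)), continuous_id.
    + apply (is_derive_id x).
Qed.

Lemma CkOn_coord2 (k : nat) (D : region) : open3 D -> CkOn k D (fun _ y _ => y).
Proof.
  intros HD. destruct k as [|k].
  - intros x y z _. split; [|exact I]. apply (cont3_coord2 (fun u => u)), continuous_id.
  - apply (CkOn_S k D _ (fun _ _ _ => 0) (fun _ _ _ => 1) (fun _ _ _ => 0)); auto;
      try (now apply CkOn_const); intros; try apply is_derive_const_R.
    + apply (cont3_coord2 (fun u => u)), continuous_id.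
    + apply (is_derive_id y).
Qed.

Lemma CkOn_coord3 (k : nat) (D : region) : open3 D -> CkOn k D (fun _ _ z => z).
Proof.
  intros HD. destruct k as [|k].
  - intros x y z _. split; [|exact I]. apply (cont3_coord3 (fun u => u)), continuous_id.
  - apply (CkOn_S k D _ (fun _ _ _ => 0) (fun _ _ _ => 0) (fun _ _ _ => 1)); auto;
      try (now apply CkOn_const); intros; try apply is_derive_const_R.
    + apply (cont3_coord3 (fun u => u)), continuous_id.
    + apply (is_derive_id z).
Qed.

Lemma CkOn_fix1 (k : nat) (D D' : region) (x1 : R) (f : R -> R -> R -> R) :
  open3 D' -> (forall x y z, D' x y z -> D x1 y z) ->
  CkOn k D f -> CkOn k D' (fun _ y z => f x1 y z).
Proof.
  intros HD' Hsub. revert f. induction k as [|k IH]; intros f Hf.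
  - intros x y z Hp. split; [|exact I].
    apply (cont3_comp3 f (fun _ _ _ => x1) (fun _ v _ => v) (fun _ _ w => w)).
    + apply (Hf x1 y z). eauto.
    + apply cont3_const.
    + apply (cont3_coord2 (fun u => u)), continuous_id.
    + apply (cont3_coord3 (fun u => u)), continuous_id.
  - apply (CkOn_S k D' _ (fun _ _ _ => 0) (fun _ y z => D2 f x1 y z)
      (fun _ y z => D3 f x1 y z) HD').
    + intros x y z Hp.
      apply (cont3_comp3 f (fun _ _ _ => x1) (fun _ v _ => v) (fun _ _ w => w)).
      * apply (Hf x1 y z). eauto.
      * apply cont3_const.
      * apply (cont3_coord2 (fun u => u)), continuous_id.
      * apply (cont3_coord3 (fun u => u)), continuous_id.
    + intros x y z Hp. apply is_derive_const_R.
    + intros x y z Hp. apply (CkOn_is_derive2 k D f Hf). eauto.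
    + intros x y z Hp. apply (CkOn_is_derive3 k D f Hf). eauto.
    + now apply CkOn_const.
    + apply (IH (D2 f)). now apply CkOn_D2.
    + apply (IH (D3 f)). now apply CkOn_D3.
Qed.

(** The substitution lam = L^2, by which an action in the parameters (lam, E) becomes one in (L, E),
    also at L = 0. *)
Lemma CkOn_square2 (k : nat) (D D' : region) (f : R -> R -> R -> R) :
  open3 D' -> (forall x y z, D' x y z -> D x (y ^ 2) z) ->
  CkOn k D f -> CkOn k D' (fun x y z => f x (y ^ 2) z).
Proof.
  intros HD' Hsub. revert f. induction k as [|k IH]; intros f Hf.
  all: assert (Hcont : forall x y z, D' x y z -> cont3 (fun x y z => f x (y ^ 2) z) x y z).
  1, 3: intros x y z Hp; apply (cont3_comp3 f (fun u _ _ => u) (fun _ v _ => v ^ 2) (fun _ _ w => w));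
    [ apply (Hf x (y ^ 2) z); auto
    | apply (cont3_coord1 (fun u => u)), continuous_id
    | apply (cont3_coord2 (fun u => u ^ 2)), (ex_derive_continuous (fun u => u ^ 2)); auto_derive; auto
    | apply (cont3_coord3 (fun u => u)), continuous_id ].
  - intros x y z Hp. split; auto.
  - apply (CkOn_S k D' _ (fun x y z => D1 f x (y ^ 2) z)
      (fun x y z => D2 f x (y ^ 2) z * (2 * y)) (fun x y z => D3 f x (y ^ 2) z) HD' Hcont).
    + intros x y z Hp. apply (CkOn_is_derive1 k D f Hf). auto.
    + intros x y z Hp. apply (is_derive_comp_R (fun u => f x u z) (fun u => u ^ 2)).
      * apply (CkOn_is_derive2 k D f Hf). auto.
      * auto_derive; auto. ring.
    + intros x y z Hp. apply (CkOn_is_derive3 k D f Hf). auto.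
    + apply (IH (D1 f)). now apply CkOn_D1.
    + apply CkOn_mult; auto.
      * apply (IH (D2 f)). now apply CkOn_D2.
      * apply CkOn_scal; auto. now apply CkOn_coord2.
    + apply (IH (D3 f)). now apply CkOn_D3.
Qed.

Lemma CkOn_Derive_n (k : nat) (D : region) (U : R -> R) (j : nat) :
  open3 D -> (forall x y z, D x y z -> 0 < x) -> smooth_potential U ->
  CkOn k D (fun x _ _ => Derive_n U j x).
Proof.
  intros HD Hpos HU. revert j.
  assert (Hd : forall j x, 0 < x -> is_derive (Derive_n U j) x (Derive_n U (S j) x)).
  { intros j x Hx. apply Derive_correct. apply (HU (S j) x Hx). }
  induction k as [|k IH]; intros j.
  - intros x y z Hp. split; [|exact I]. apply cont3_coord1.
    apply (ex_derive_continuous (Derive_n U j)). eexists. apply Hd. eauto.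
  - apply (CkOn_S k D _ (fun x _ _ => Derive_n U (S j) x) (fun _ _ _ => 0) (fun _ _ _ => 0));
      auto; try (now apply CkOn_const); try (intros; apply is_derive_const_R).
    + intros x y z Hp. apply cont3_coord1.
      apply (ex_derive_continuous (Derive_n U j)). eexists. apply Hd. eauto.
    + intros x y z Hp. apply Hd. eauto.
Qed.

(* [sqrt] vanishes on negative arguments, so this is the positive part of y^(j + 1/2). *)
Definition half_power (j : nat) (y : R) : R := y ^ j * sqrt y.

Lemma half_power_nonpos (j : nat) (y : R) : y <= 0 -> half_power j y = 0.
Proof. intros Hy. unfold half_power. rewrite sqrt_neg_0; [ring | exact Hy]. Qed.

Lemma continuous_half_power (j : nat) (y : R) : continuous (half_power j) y.
Proof.
  apply (continuous_mult (fun y => y ^ j) sqrt); [|apply continuous_sqrt].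
  apply (ex_derive_continuous (fun y => y ^ j)). auto_derive. exact I.
Qed.

Lemma is_derive_half_power (j : nat) (y : R) :
  is_derive (half_power (S j)) y ((INR j + 3 / 2) * half_power j y).
Proof.
  destruct (Rtotal_order y 0) as [Hy | [Hy | Hy]].
  - rewrite half_power_nonpos, Rmult_0_r; [|lra].
    apply (is_derive_ext_loc (fun _ => 0)); [|apply (is_derive_const_R 0)].
    generalize (open_lt 0 y Hy). apply filter_imp.
    intros u Hu. symmetry. apply half_power_nonpos. lra.
  (* At 0 the difference quotient of [half_power (S j)] is exactly [half_power j h], for h of either
     sign, so continuity of the lower half power at 0 gives the derivative. *)
  - subst y. rewrite (half_power_nonpos j 0) by lra. rewrite Rmult_0_r.
    apply is_derive_Reals. intros eps Heps.
    destruct (proj1 (filterlim_locally _ _) (continuous_half_power j 0) (mkposreal eps Heps))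
      as [d Hd].
    exists d. intros h Hh0 Hh.
    replace ((half_power (S j) (0 + h) - half_power (S j) 0) / h - 0) with (half_power j h).
    + specialize (Hd h). change (Rabs (h - 0) < d -> Rabs (half_power j h - half_power j 0) < eps) in Hd.
      rewrite (half_power_nonpos j 0), !Rminus_0_r in Hd by lra. auto.
    + rewrite (half_power_nonpos (S j) 0) by lra. unfold half_power.
      rewrite Rplus_0_l. simpl. field. exact Hh0.
  - assert (Hs := sqrt_lt_R0 y Hy).
    apply (is_derive_eq _ _ ((INR (S j) * y ^ j) * sqrt y + y ^ S j * / (2 * sqrt y))).
    + apply (is_derive_mult_R (fun y => y ^ S j) sqrt).
      * apply (is_derive_eq _ _ (INR (S j) * 1 * y ^ j)); [|ring].
        apply (is_derive_pow (fun y => y) (S j) y 1), (is_derive_id y).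
      * auto_derive; auto. ring.
    + rewrite S_INR. unfold half_power. simpl.
      rewrite <- (sqrt_sqrt y) at 3 by lra. field. lra.
Qed.

(** Each differentiation uses up one of the [k] integer powers and leaves a continuous half power at
    the end. With [j = 0] the positive part of y^(k + 1/2) is C^k, across its zero included. *)
Lemma CkOn_half_power (k j : nat) (D : region) (f : R -> R -> R -> R) :
  open3 D -> CkOn k D f -> CkOn k D (fun x y z => half_power (k + j) (f x y z)).
Proof.
  intros HD. induction k as [|k IH]; intros Hf.
  - intros x y z Hp. split; [|exact I]. apply cont3_comp; [apply (Hf x y z Hp) |].
    apply continuous_half_power.
  - simpl. apply (CkOn_comp_S k D (half_power (S (k + j)))
      (fun u => (INR (k + j) + 3 / 2) * half_power (k + j) u)); auto.
    + intros x y z Hp. apply is_derive_half_power.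
    + apply CkOn_scal; auto. apply IH. now apply CkOn_pred.
Qed.

(** * Mixed derivatives, parametric integrals and the chain rule *)

(** A product region: for parameters fixed in the box, the whole segment between two admissible
    radii stays inside. The radial interval has to hold a path of integration and so is independent
    of the small parameter radius [d]. *)
Definition slab (al be y0 z0 d : R) : region :=
  fun x y z => al < x < be /\ Rabs (y - y0) < d /\ Rabs (z - z0) < d.

Lemma Rabs_lt_trans_ball (u u' u0 d e : R) :
  Rabs (u' - u) < e -> e <= d - Rabs (u - u0) -> Rabs (u' - u0) < d.
Proof.
  intros H1 H2. replace (u' - u0) with ((u' - u) + (u - u0)) by ring.
  eapply Rle_lt_trans; [apply Rabs_triang | lra].
Qed.

Lemma Rmin_pos_lt (a b u : R) : u < Rmin a b -> u < a /\ u < b.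
Proof. generalize (Rmin_l a b) (Rmin_r a b). lra. Qed.

Lemma open3_slab (al be y0 z0 d : R) : open3 (slab al be y0 z0 d).
Proof.
  intros x y z (Hx & Hy & Hz).
  assert (He : 0 < Rmin (Rmin (x - al) (be - x)) (Rmin (d - Rabs (y - y0)) (d - Rabs (z - z0)))).
  { repeat apply Rmin_pos; lra. }
  exists (mkposreal _ He). simpl. intros x' y' z' H1 H2 H3.
  apply Rmin_pos_lt in H1. apply Rmin_pos_lt in H2. apply Rmin_pos_lt in H3.
  destruct H1 as [H1 _], H2 as [_ H2], H3 as [_ H3].
  apply Rmin_pos_lt in H1. apply Rmin_pos_lt in H2. apply Rmin_pos_lt in H3.
  repeat split.
  - destruct H1 as [H1 _]. apply Rabs_def2 in H1. lra.
  - destruct H1 as [_ H1]. apply Rabs_def2 in H1. lra.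
  - eapply Rabs_lt_trans_ball; [apply (proj1 H2) | apply Rle_refl].
  - eapply Rabs_lt_trans_ball; [apply (proj2 H3) | apply Rle_refl].
Qed.

Lemma open3_pos (D : region) (f : R -> R -> R -> R) :
  open3 D -> (forall x y z, D x y z -> cont3 f x y z) ->
  open3 (fun x y z => D x y z /\ 0 < f x y z).
Proof.
  intros HD Hf x y z [Hp Hfp].
  destruct (HD _ _ _ Hp) as [d Hd].
  destruct (proj1 (cont3_spec f x y z) (Hf x y z Hp) (mkposreal _ Hfp)) as [d' Hd'].
  exists (mkposreal _ (Rmin_stable_in_posreal d d')). simpl in *. intros x' y' z' H1 H2 H3.
  apply Rmin_pos_lt in H1. apply Rmin_pos_lt in H2. apply Rmin_pos_lt in H3.
  split; [apply Hd; tauto |].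
  assert (H : Rabs (f x' y' z' - f x y z) < f x y z) by (apply Hd'; tauto).
  apply Rabs_def2 in H. lra.
Qed.

Lemma cont3_slices (f : R -> R -> R -> R) (x y z : R) : cont3 f x y z ->
  continuity_2d_pt (fun u v => f u v z) x y /\
  continuity_2d_pt (fun u v => f u y v) x z /\
  continuity_2d_pt (fun u v => f x u v) y z.
Proof.
  rewrite cont3_spec. intros H.
  assert (H0 : forall (d : posreal) (u : R), Rabs (u - u) < d).
  { intros d u. rewrite Rminus_eq_0, Rabs_R0. apply cond_pos. }
  repeat split; intros eps; destruct (H eps) as [d Hd]; exists d; intros u v Hu Hv; auto.
Qed.

Lemma cont3_line1 (f : R -> R -> R -> R) (x y z : R) :
  cont3 f x y z -> continuous (fun u => f u y z) x.
Proof.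
  rewrite cont3_spec. intros H. apply filterlim_locally. intros eps.
  destruct (H eps) as [d Hd]. exists d. intros u Hu.
  apply Hd; [exact Hu | |]; rewrite Rminus_eq_0, Rabs_R0; apply cond_pos.
Qed.

Lemma open3_slices (D : region) (x y z : R) : open3 D -> D x y z ->
  locally_2d (fun u v => D u v z) x y /\
  locally_2d (fun u v => D u y v) x z /\
  locally_2d (fun u v => D x u v) y z.
Proof.
  intros HD Hp. destruct (HD _ _ _ Hp) as [d Hd].
  assert (H0 : forall u : R, Rabs (u - u) < d).
  { intros u. rewrite Rminus_eq_0, Rabs_R0. apply cond_pos. }
  repeat split; exists d; intros u v Hu Hv; apply Hd; auto.
Qed.

Section Schwarz3.

Variables (D : region) (f : R -> R -> R -> R).
Hypotheses (HD : open3 D) (Hf : CkOn 2 D f).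

Let H1 : CkOn 1 D (D1 f) := CkOn_D1 1 D f Hf.
Let H2 : CkOn 1 D (D2 f) := CkOn_D2 1 D f Hf.
Let H3 : CkOn 1 D (D3 f) := CkOn_D3 1 D f Hf.

Lemma Schwarz12 (x y z : R) : D x y z -> D1 (D2 f) x y z = D2 (D1 f) x y z.
Proof.
  intros Hp. apply (Schwarz (fun u v => f u v z) x y).
  - destruct (open3_slices D x y z HD Hp) as (HL & _ & _). revert HL.
    apply locally_2d_impl, locally_2d_forall. intros u v Huv. repeat split.
    + apply (Hf u v z Huv).
    + apply (Hf u v z Huv).
    + apply (H2 u v z Huv).
    + apply (H1 u v z Huv).
  - apply (cont3_slices (D1 (D2 f)) x y z), (H2 x y z Hp).
  - apply (cont3_slices (D2 (D1 f)) x y z), (H1 x y z Hp).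
Qed.

Lemma Schwarz13 (x y z : R) : D x y z -> D1 (D3 f) x y z = D3 (D1 f) x y z.
Proof.
  intros Hp. apply (Schwarz (fun u v => f u y v) x z).
  - destruct (open3_slices D x y z HD Hp) as (_ & HL & _). revert HL.
    apply locally_2d_impl, locally_2d_forall. intros u v Huv. repeat split.
    + apply (Hf u y v Huv).
    + apply (Hf u y v Huv).
    + apply (H3 u y v Huv).
    + apply (H1 u y v Huv).
  - apply (cont3_slices (D1 (D3 f)) x y z), (H3 x y z Hp).
  - apply (cont3_slices (D3 (D1 f)) x y z), (H1 x y z Hp).
Qed.

Lemma Schwarz23 (x y z : R) : D x y z -> D2 (D3 f) x y z = D3 (D2 f) x y z.
Proof.
  intros Hp. apply (Schwarz (fun u v => f x u v) y z).
  - destruct (open3_slices D x y z HD Hp) as (_ & _ & HL). revert HL.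
    apply locally_2d_impl, locally_2d_forall. intros u v Huv. repeat split.
    + apply (Hf x u v Huv).
    + apply (Hf x u v Huv).
    + apply (H3 x u v Huv).
    + apply (H2 x u v Huv).
  - apply (cont3_slices (D2 (D3 f)) x y z), (H3 x y z Hp).
  - apply (cont3_slices (D3 (D2 f)) x y z), (H2 x y z Hp).
Qed.

End Schwarz3.

(** * Compactness of a segment and integrals depending on parameters *)

Lemma uniform_on_segment (F : R -> R -> R -> R) (a b y z : R) (eps : posreal) :
  (forall s, a <= s <= b -> cont3 F s y z) ->
  exists d : posreal, forall s y' z', a <= s <= b ->
    Rabs (y' - y) < d -> Rabs (z' - z) < d -> Rabs (F s y' z' - F s y z) < eps.
Proof.
  intros HF.
  assert (Hex : forall s, exists d : posreal, a <= s <= b -> forall s' y' z',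
    Rabs (s' - s) < d -> Rabs (y' - y) < d -> Rabs (z' - z) < d ->
    Rabs (F s' y' z' - F s y z) < eps / 2).
  { intros s. destruct (excluded_middle_informative (a <= s <= b)) as [Hs | Hs].
    - destruct (proj1 (cont3_spec F s y z) (HF s Hs) (pos_div_2 eps)) as [d Hd].
      exists d. intros _. exact Hd.
    - exists eps. intros H. contradiction. }
  (* The compactness lemma asks for a radius at every real number, so the local moduli of continuity
     are collected by choice; off the segment the radius is the dummy value [eps]. *)
  destruct (compactness_value_1d a b
    (fun s => proj1_sig (constructive_indefinite_description _ (Hex s)))) as [d Hd].
  (* The covering point is only provided under a double negation, hence the passage to a
     contradiction. Both values of [F] are then compared with the one at the covering point [t],
     each at cost [eps / 2]. *)
  exists d. intros s y' z' Hs Hy Hz. apply Rnot_le_lt. intros Hle.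
  apply (Hd s Hs). intros (t & Ht & Hst & Hdt).
  destruct (constructive_indefinite_description _ (Hex t)) as [dt Hdt']. simpl in *.
  assert (A1 := Hdt' Ht s y' z' Hst (Rlt_le_trans _ _ _ Hy Hdt) (Rlt_le_trans _ _ _ Hz Hdt)).
  assert (A2 : Rabs (F s y z - F t y z) < eps / 2).
  { apply (Hdt' Ht); [exact Hst | |]; rewrite Rminus_eq_0, Rabs_R0; apply cond_pos. }
  apply Rabs_def2 in A1. apply Rabs_def2 in A2.
  revert Hle. apply Rlt_not_le, Rabs_def1; lra.
Qed.

Section ParametricIntegral.

Variables (al be y0 z0 d c : R).
Hypothesis Hc : al < c < be.
Let D := slab al be y0 z0 d.

Lemma slab_segment (x y z s : R) : D x y z -> Rmin c x <= s <= Rmax c x -> D s y z.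
Proof.
  intros [Hx Hyz] Hs. split; [|exact Hyz].
  revert Hs. unfold Rmin, Rmax. destruct Rle_dec; lra.
Qed.

Lemma ex_RInt_slab (F : R -> R -> R -> R) (x y z : R) :
  (forall x y z, D x y z -> cont3 F x y z) -> D x y z -> ex_RInt (fun s => F s y z) c x.
Proof.
  intros HF Hp. apply (ex_RInt_continuous (V := R_CompleteNormedModule)).
  intros s Hs. apply (cont3_line1 F), HF. eapply slab_segment; eauto.
Qed.

Lemma is_derive_RInt_slab (F : R -> R -> R -> R) (x y z : R) :
  (forall x y z, D x y z -> cont3 F x y z) -> D x y z ->
  is_derive (fun u => RInt (fun s => F s y z) c u) x (F x y z).
Proof.
  intros HF Hp. apply (is_derive_RInt (fun s => F s y z) _ c x).
  - destruct (open3_lines D x y z (open3_slab _ _ _ _ _) Hp) as (HL & _ & _).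
    revert HL. apply filter_imp. intros u Hu.
    apply (RInt_correct (V := R_CompleteNormedModule)), ex_RInt_slab; auto.
  - apply (cont3_line1 F), HF, Hp.
Qed.

(** The increment is split in two. Moving the upper limit at fixed parameters is continuous because
    the integral is differentiable there; moving the parameters at a fixed limit costs at most the
    length times a uniform bound on the change of the integrand. *)
Lemma cont3_RInt (F : R -> R -> R -> R) (x y z : R) :
  (forall x y z, D x y z -> cont3 F x y z) -> D x y z ->
  cont3 (fun x y z => RInt (fun s => F s y z) c x) x y z.
Proof.
  intros HF Hp. apply cont3_spec. intros eps.
  (* The midpoints give a compact segment inside (al, be) that contains [c] and a neighbourhood of
     [x]; its length [b - a] bounds the length of every integral below. *)
  set (a := (al + Rmin c x) / 2). set (b := (be + Rmax c x) / 2).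
  assert (Hab : al < a /\ a < Rmin c x /\ Rmax c x < b /\ b < be).
  { unfold a, b. destruct Hp as [Hx _]. unfold Rmin, Rmax. destruct Rle_dec; lra. }
  assert (Hax : a < x < b /\ a < c < b).
  { generalize (Rmin_l c x) (Rmin_r c x) (Rmax_l c x) (Rmax_r c x). lra. }
  assert (He1 : 0 < eps / 2 / (b - a)).
  { apply Rdiv_lt_0_compat; [apply is_pos_div_2 | lra]. }
  destruct (uniform_on_segment F a b y z (mkposreal _ He1)) as [d1 Hd1].
  { intros s Hs. apply HF. destruct Hp as [_ Hyz]. split; [lra | exact Hyz]. }
  assert (Hcx : continuous (fun u => RInt (fun s => F s y z) c u) x).
  { apply (ex_derive_continuous (fun u => RInt (fun s => F s y z) c u)).
    eexists. apply is_derive_RInt_slab; auto. }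
  destruct (proj1 (filterlim_locally _ _) Hcx (pos_div_2 eps)) as [d2 Hd2].
  destruct (open3_slab _ _ _ _ _ _ _ _ Hp) as [d3 Hd3].
  assert (Hd : 0 < Rmin (Rmin d1 d2) (Rmin d3 (Rmin (x - a) (b - x)))).
  { repeat apply Rmin_pos; try apply cond_pos; lra. }
  exists (mkposreal _ Hd). simpl. intros x' y' z' Hx Hy Hz.
  apply Rmin_pos_lt in Hx. destruct Hx as [Hx Hx'].
  apply Rmin_pos_lt in Hx. apply Rmin_pos_lt in Hx'.
  destruct Hx' as [Hx3 Hx4]. apply Rmin_pos_lt in Hx4.
  apply Rmin_pos_lt in Hy. destruct Hy as [Hy Hy'].
  apply Rmin_pos_lt in Hy. apply Rmin_pos_lt in Hy'.
  apply Rmin_pos_lt in Hz. destruct Hz as [Hz Hz'].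
  apply Rmin_pos_lt in Hz. apply Rmin_pos_lt in Hz'.
  assert (Hp' : D x' y' z') by (apply Hd3; tauto).
  assert (Hp'' : D x' y z) by (destruct Hp as [_ ?], Hp' as [? _]; now split).
  assert (Hx'ab : a < x' < b).
  { destruct Hx4 as [Hx4 Hx5]. apply Rabs_def2 in Hx4. apply Rabs_def2 in Hx5. lra. }
  assert (B1 : Rabs (RInt (fun s => F s y z) c x' - RInt (fun s => F s y z) c x) < eps / 2).
  { apply (Hd2 x'). apply Hx. }
  assert (B2 : Rabs (RInt (fun s => F s y' z') c x' - RInt (fun s => F s y z) c x')
    <= Rabs (x' - c) * (eps / 2 / (b - a))).
  { apply (norm_RInt_le_const_abs (fun s => F s y' z' - F s y z) c x').
    - intros s Hs. apply Rlt_le, Hd1; try tauto.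
      revert Hs. unfold Rmin, Rmax. destruct Rle_dec; lra.
    - apply (is_RInt_minus (V := R_NormedModule));
        apply (RInt_correct (V := R_CompleteNormedModule)), ex_RInt_slab; auto. }
  assert (B3 : Rabs (x' - c) * (eps / 2 / (b - a)) <= eps / 2).
  { replace (eps / 2) with ((b - a) * (eps / 2 / (b - a))) at 2 by (field; lra).
    apply Rmult_le_compat_r; [lra |]. apply Rabs_le. lra. }
  apply Rabs_def2 in B1. assert (B4 := Rle_trans _ _ _ B2 B3).
  apply Rabs_le_between in B4. apply Rabs_def1; lra.
Qed.

Lemma is_derive_RInt_slab2 (F : R -> R -> R -> R) (x y z : R) :
  CkOn 1 D F -> D x y z ->
  is_derive (fun u => RInt (fun s => F s u z) c x) y (RInt (fun s => D2 F s y z) c x).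
Proof.
  intros HF Hp. apply (is_derive_RInt_param (fun u s => F s u z) c x y).
  - destruct (open3_lines D x y z (open3_slab _ _ _ _ _) Hp) as (_ & HL & _).
    revert HL. apply filter_imp. intros u Hu s Hs.
    apply (HF s u z), (slab_segment x u z s Hu Hs).
  - intros s Hs. assert (Hq := slab_segment x y z s Hp Hs).
    destruct (cont3_slices (D2 F) s y z) as (HS & _ & _).
    { apply (HF s y z Hq). }
    intros eps. destruct (HS eps) as [e He]. exists e. intros u v Hu Hv. now apply He.
  - destruct (open3_lines D x y z (open3_slab _ _ _ _ _) Hp) as (_ & HL & _).
    revert HL. apply filter_imp. intros u Hu. apply ex_RInt_slab; auto.
    intros. eapply CkOn_cont; eauto.
Qed.

Lemma is_derive_RInt_slab3 (F : R -> R -> R -> R) (x y z : R) :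
  CkOn 1 D F -> D x y z ->
  is_derive (fun u => RInt (fun s => F s y u) c x) z (RInt (fun s => D3 F s y z) c x).
Proof.
  intros HF Hp. apply (is_derive_RInt_param (fun u s => F s y u) c x z).
  - destruct (open3_lines D x y z (open3_slab _ _ _ _ _) Hp) as (_ & _ & HL).
    revert HL. apply filter_imp. intros u Hu s Hs.
    apply (HF s y u), (slab_segment x y u s Hu Hs).
  - intros s Hs. assert (Hq := slab_segment x y z s Hp Hs).
    destruct (cont3_slices (D3 F) s y z) as (_ & HS & _).
    { apply (HF s y z Hq). }
    intros eps. destruct (HS eps) as [e He]. exists e. intros u v Hu Hv. now apply He.
  - destruct (open3_lines D x y z (open3_slab _ _ _ _ _) Hp) as (_ & _ & HL).
    revert HL. apply filter_imp. intros u Hu. apply ex_RInt_slab; auto.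
    intros. eapply CkOn_cont; eauto.
Qed.

Lemma CkOn_RInt (k : nat) (F : R -> R -> R -> R) :
  CkOn k D F -> CkOn k D (fun x y z => RInt (fun s => F s y z) c x).
Proof.
  revert F. induction k as [|k IH]; intros F HF.
  - intros x y z Hp. split; [|exact I]. apply cont3_RInt; auto.
    intros. eapply CkOn_cont; eauto.
  - assert (HF1 : CkOn 1 D F).
    { clear IH. revert HF. induction k as [|k IH]; [auto |]. intros HF. apply IH, CkOn_pred, HF. }
    apply (CkOn_S k D _ F (fun x y z => RInt (fun s => D2 F s y z) c x)
      (fun x y z => RInt (fun s => D3 F s y z) c x)).
    + apply open3_slab.
    + intros x y z Hp. apply cont3_RInt; auto. intros. eapply CkOn_cont; eauto.
    + intros x y z Hp. apply is_derive_RInt_slab; auto. intros. eapply CkOn_cont; eauto.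
    + intros x y z Hp. apply is_derive_RInt_slab2; auto.
    + intros x y z Hp. apply is_derive_RInt_slab3; auto.
    + now apply CkOn_pred.
    + apply IH. now apply CkOn_D2.
    + apply IH. now apply CkOn_D3.
Qed.

End ParametricIntegral.

(** One summand of the telescoped chain rule: [P] is the increment of a function of three variables
    when only its argument [a] moves, and [k] is the partial derivative. The error is measured
    against [a s - a s0], which may vanish, so no quotient by it is formed. *)
Lemma is_derive_of_linear_bound (P a : R -> R) (s0 k a' : R) :
  P s0 = 0 -> is_derive a s0 a' ->
  (forall eps : posreal, locally s0 (fun s => Rabs (P s - k * (a s - a s0)) <= eps * Rabs (a s - a s0))) ->
  is_derive P s0 (k * a').
Proof.
  intros HP Ha HB.
  assert (Hk : is_derive (fun s => k * (a s - a s0)) s0 (k * a')).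
  { apply (is_derive_eq _ _ (k * (a' - 0))); [|ring].
    apply (is_derive_scal (fun s => a s - a s0) s0 k).
    apply (is_derive_minus a (fun _ => a s0)); [exact Ha | apply is_derive_const_R]. }
  assert (Hz : is_derive (fun s => P s - k * (a s - a s0)) s0 0).
  { split; [apply is_linear_scal_l |]. intros x Hx.
    apply (is_filter_lim_locally_unique s0) in Hx. subst x. intros eps.
    destruct Ha as [_ Ha]. specialize (Ha s0 (fun P H => H)).
    assert (HM : 0 < Rabs a' + 1) by (generalize (Rabs_pos a'); lra).
    assert (He : 0 < eps / (Rabs a' + 1)) by (apply Rdiv_lt_0_compat; [apply cond_pos | lra]).
    (* Differentiability of [a] with tolerance 1 bounds its increment by (|a'| + 1) |s - s0|, which
       explains the divisor in the choice of the tolerance for [HB]. *)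
    generalize (filter_and _ _ (HB (mkposreal _ He)) (Ha (mkposreal 1 Rlt_0_1))).
    apply filter_imp. intros s [H1 H2].
    change (Rabs (a s - a s0 - (s - s0) * a') <= 1 * Rabs (s - s0)) in H2.
    change (Rabs (P s - k * (a s - a s0) - (P s0 - k * (a s0 - a s0)) - (s - s0) * 0)
      <= eps * Rabs (s - s0)).
    replace (P s - k * (a s - a s0) - (P s0 - k * (a s0 - a s0)) - (s - s0) * 0)
      with (P s - k * (a s - a s0)) by (rewrite HP; ring).
    eapply Rle_trans; [apply H1 |]. simpl.
    assert (H3 : Rabs (a s - a s0) <= (Rabs a' + 1) * Rabs (s - s0)).
    { replace (a s - a s0) with ((a s - a s0 - (s - s0) * a') + (s - s0) * a') by ring.
      eapply Rle_trans; [apply Rabs_triang |]. rewrite (Rabs_mult (s - s0)). lra. }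
    replace (eps * Rabs (s - s0))
      with (eps / (Rabs a' + 1) * ((Rabs a' + 1) * Rabs (s - s0))) by (field; lra).
    apply Rmult_le_compat_l; lra. }
  apply (is_derive_ext_R (fun s => (P s - k * (a s - a s0)) + k * (a s - a s0))).
  { intros s. ring. }
  apply (is_derive_eq _ _ (0 + k * a')); [|ring].
  now apply is_derive_plus_R.
Qed.

Lemma increment_bound (h : R -> R) (dh : R -> R) (x x' k e : R) :
  (forall u, Rmin x x' <= u <= Rmax x x' -> is_derive h u (dh u) /\ Rabs (dh u - k) <= e) ->
  Rabs (h x' - h x - k * (x' - x)) <= e * Rabs (x' - x).
Proof.
  intros H. destruct (MVT_gen h x x' dh) as (c & Hc & Heq).
  - intros u Hu. apply H. lra.
  - intros u Hu. apply continuity_pt_filterlim.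
    apply (ex_derive_continuous h). eexists. apply H, Hu.
  - rewrite Heq. replace (dh c * (x' - x) - k * (x' - x)) with ((dh c - k) * (x' - x)) by ring.
    rewrite Rabs_mult. apply Rmult_le_compat_r; [apply Rabs_pos | apply H, Hc].
Qed.

Lemma Rabs_between (x x' u : R) : Rmin x x' <= u <= Rmax x x' -> Rabs (u - x) <= Rabs (x' - x).
Proof.
  unfold Rmin, Rmax. destruct Rle_dec; intros Hu.
  - rewrite !Rabs_pos_eq; lra.
  - rewrite <- (Rabs_Ropp (u - x)), <- (Rabs_Ropp (x' - x)), !Rabs_pos_eq; lra.
Qed.

Lemma is_derive_chain3 (D : region) (f : R -> R -> R -> R) (a b c : R -> R) (s0 a' b' c' : R) :
  open3 D -> CkOn 1 D f -> D (a s0) (b s0) (c s0) ->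
  is_derive a s0 a' -> is_derive b s0 b' -> is_derive c s0 c' ->
  is_derive (fun s => f (a s) (b s) (c s)) s0
    (D1 f (a s0) (b s0) (c s0) * a' + D2 f (a s0) (b s0) (c s0) * b'
     + D3 f (a s0) (b s0) (c s0) * c').
Proof.
  intros HD Hf Hp Ha Hb Hc.
  assert (Hnear : forall d : posreal, locally s0 (fun s => Rabs (a s - a s0) < d /\
    Rabs (b s - b s0) < d /\ Rabs (c s - c s0) < d)).
  { intros d. repeat apply filter_and.
    - apply (proj1 (filterlim_locally a (a s0))
        (ex_derive_continuous a s0 (ex_intro _ _ Ha)) d).
    - apply (proj1 (filterlim_locally b (b s0))
        (ex_derive_continuous b s0 (ex_intro _ _ Hb)) d).
    - apply (proj1 (filterlim_locally c (c s0))
        (ex_derive_continuous c s0 (ex_intro _ _ Hc)) d). }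
  assert (Hbox : forall g : R -> R -> R -> R, cont3 g (a s0) (b s0) (c s0) ->
    forall eps : posreal, exists d : posreal, forall x y z,
    Rabs (x - a s0) < d -> Rabs (y - b s0) < d -> Rabs (z - c s0) < d ->
    D x y z /\ Rabs (g x y z - g (a s0) (b s0) (c s0)) <= eps).
  { intros g Hg eps. destruct (HD _ _ _ Hp) as [d Hd].
    destruct (proj1 (cont3_spec _ _ _ _) Hg eps) as [d' Hd'].
    exists (mkposreal _ (Rmin_stable_in_posreal d d')). simpl. intros x y z H1 H2 H3.
    apply Rmin_pos_lt in H1. apply Rmin_pos_lt in H2. apply Rmin_pos_lt in H3.
    split; [apply Hd | apply Rlt_le, Hd']; tauto. }
  assert (H0 : forall (d : posreal) u, Rabs (u - u) < d).
  { intros d u. rewrite Rminus_eq_0, Rabs_R0. apply cond_pos. }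
  (* The increment is telescoped so that each bracket moves a single coordinate. Then the
     one-variable mean value theorem and continuity of that partial derivative at the base point
     suffice. *)
  apply (is_derive_ext_R (fun s =>
    (f (a s) (b s) (c s) - f (a s0) (b s) (c s))
    + (f (a s0) (b s) (c s) - f (a s0) (b s0) (c s))
    + (f (a s0) (b s0) (c s) - f (a s0) (b s0) (c s0)) + f (a s0) (b s0) (c s0))).
  { intros s. simpl. ring. }
  apply (is_derive_eq _ _ ((D1 f (a s0) (b s0) (c s0) * a' + D2 f (a s0) (b s0) (c s0) * b'
     + D3 f (a s0) (b s0) (c s0) * c') + 0)); [|ring].
  apply is_derive_plus_R; [|apply is_derive_const_R].
  apply (is_derive_plus_R (fun s => (f (a s) (b s) (c s) - f (a s0) (b s) (c s))
    + (f (a s0) (b s) (c s) - f (a s0) (b s0) (c s))));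
    [apply is_derive_plus_R |].
  - apply (is_derive_of_linear_bound _ a); [ring | exact Ha |]. intros eps.
    destruct (Hbox (D1 f)) with (eps := eps) as [d Hd]; [apply (Hf _ _ _ Hp) |].
    generalize (Hnear d). apply filter_imp. intros s (Ka & Kb & Kc).
    apply (increment_bound (fun u => f u (b s) (c s)) (fun u => D1 f u (b s) (c s))).
    intros u Hu. apply Rabs_between in Hu.
    destruct (Hd u (b s) (c s)) as [Hd1 Hd2]; auto; [lra |].
    split; [apply (CkOn_is_derive1 0 D f Hf), Hd1 | exact Hd2].
  - apply (is_derive_of_linear_bound _ b); [ring | exact Hb |]. intros eps.
    destruct (Hbox (D2 f)) with (eps := eps) as [d Hd]; [apply (Hf _ _ _ Hp) |].
    generalize (Hnear d). apply filter_imp. intros s (Ka & Kb & Kc).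
    apply (increment_bound (fun u => f (a s0) u (c s)) (fun u => D2 f (a s0) u (c s))).
    intros u Hu. apply Rabs_between in Hu.
    destruct (Hd (a s0) u (c s)) as [Hd1 Hd2]; auto; [lra |].
    split; [apply (CkOn_is_derive2 0 D f Hf), Hd1 | exact Hd2].
  - apply (is_derive_of_linear_bound _ c); [ring | exact Hc |]. intros eps.
    destruct (Hbox (D3 f)) with (eps := eps) as [d Hd]; [apply (Hf _ _ _ Hp) |].
    generalize (Hnear d). apply filter_imp. intros s (Ka & Kb & Kc).
    apply (increment_bound (fun u => f (a s0) (b s0) u) (fun u => D3 f (a s0) (b s0) u)).
    intros u Hu. apply Rabs_between in Hu.
    destruct (Hd (a s0) (b s0) u) as [Hd1 Hd2]; auto; [lra |].
    split; [apply (CkOn_is_derive3 0 D f Hf), Hd1 | exact Hd2].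
Qed.

(** * Integrals of half powers *)

(** All orders at once, since every integration by parts below consumes a derivative. *)
Definition smooth_on (D : region) (f : R -> R -> R -> R) : Prop := forall k, CkOn k D f.

(* Integration by parts: each step trades one more half power of [g] for a derivative of
   the smooth factor divided by [g']. *)
Lemma half_power_reduce (D : region) (g : R -> R -> R -> R) (i : nat) (phi : R -> R -> R -> R) :
  open3 D -> smooth_on D g -> (forall x y z, D x y z -> D1 g x y z <> 0) -> smooth_on D phi ->
  exists b rem : R -> R -> R -> R, smooth_on D b /\ smooth_on D rem /\
    forall x y z, D x y z ->
      is_derive (fun u => half_power 1 (g u y z) * b u y z) x
        (half_power 0 (g x y z) * phi x y z - half_power i (g x y z) * rem x y z).
Proof.
  intros HD Hg Hn Hphi. induction i as [|i (b & rem & Hb & Hrem & Hder)].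
  - exists (fun _ _ _ => 0), phi. split; [intros k; now apply CkOn_const | split; [exact Hphi |]].
    intros x y z Hp. apply (is_derive_ext_R (fun _ => 0)); [intros; ring |].
    eapply is_derive_eq; [apply is_derive_const_R | ring].
  (* The derivative of g^(i + 3/2) q is (i + 3/2) g^(i + 1/2) g' q + g^(i + 3/2) q'. Choosing q =
     rem / ((i + 3/2) g') cancels the old remainder and leaves -q' as the new one. The factor g^i is
     absorbed into [b], so that the boundary term keeps the shape g^(3/2) b. *)
  - set (c := / (INR i + 3 / 2)).
    set (q := fun x y z => c * (rem x y z * / D1 g x y z)).
    assert (Hc : INR i + 3 / 2 <> 0) by (generalize (pos_INR i); lra).
    assert (Hq : smooth_on D q).
    { intros k. apply CkOn_scal, CkOn_mult; auto. apply CkOn_inv; auto. apply CkOn_D1, Hg. }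
    assert (Hpow : smooth_on D (fun x y z => g x y z ^ i)).
    { intros k. clear - HD Hg. induction i as [|i IH].
      - apply (CkOn_const k D 1 HD).
      - apply (CkOn_mult k D g); auto. }
    exists (fun x y z => b x y z + g x y z ^ i * q x y z), (fun x y z => - 1 * D1 q x y z).
    split; [intros k; apply CkOn_plus; auto; apply CkOn_mult; auto |
      split; [intros k; apply CkOn_scal; auto; apply CkOn_D1; auto |]].
    intros x y z Hp.
    apply (is_derive_ext_R (fun u => half_power 1 (g u y z) * b u y z
      + half_power (S i) (g u y z) * q u y z)).
    { intros u. unfold half_power. simpl. ring. }
    eapply is_derive_eq.
    { apply is_derive_plus_R; [apply Hder, Hp |].
      apply (is_derive_mult_R (fun u => half_power (S i) (g u y z)) (fun u => q u y z)).
      - apply (is_derive_comp_R (half_power (S i)) (fun u => g u y z)).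
        + apply is_derive_half_power.
        + apply (CkOn_is_derive1 0 D g (Hg 1%nat)), Hp.
      - apply (CkOn_is_derive1 0 D q (Hq 1%nat)), Hp. }
    assert (Eq : q x y z * D1 g x y z * (INR i + 3 / 2) = rem x y z).
    { unfold q, c. field. generalize (pos_INR i). split; [apply Hn, Hp | lra]. }
    rewrite <- Eq. ring.
Qed.

Lemma pos_factor (a b : R) : 0 < a * b -> 0 < a -> 0 < b.
Proof. intros H Ha. apply (Rmult_lt_reg_l a); lra. Qed.

Lemma CkOn_3_1 (D : region) (f : R -> R -> R -> R) : CkOn 3 D f -> CkOn 1 D f.
Proof. intros H. now apply CkOn_pred, CkOn_pred. Qed.

(* [s] is a positive or negative number telling on which side of its zero the
   function [g] is positive. *)
Lemma increasing_sign (al be y0 z0 d s rho x y z : R) (g : R -> R -> R -> R) :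
  CkOn 1 (slab al be y0 z0 d) g ->
  (forall x y z, slab al be y0 z0 d x y z -> 0 < s * D1 g x y z) ->
  slab al be y0 z0 d rho y z -> slab al be y0 z0 d x y z -> g rho y z = 0 ->
  (0 < s * (x - rho) -> 0 < g x y z) /\ (s * (x - rho) <= 0 -> g x y z <= 0).
Proof.
  intros Hg Hs Hrho Hx H0.
  destruct (MVT_gen (fun u => g u y z) rho x (fun u => D1 g u y z)) as (xi & Hxi & Heq).
  - intros u Hu. apply (CkOn_is_derive1 0 _ g Hg).
    destruct Hrho as [Hrho Hyz], Hx as [Hx _]. split; [|exact Hyz].
    revert Hu. unfold Rmin, Rmax. destruct Rle_dec; lra.
  - intros u Hu. apply continuity_pt_filterlim, (cont3_line1 g), (CkOn_cont 1 _ g Hg).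
    destruct Hrho as [Hrho Hyz], Hx as [Hx _]. split; [|exact Hyz].
    revert Hu. unfold Rmin, Rmax. destruct Rle_dec; lra.
  - assert (Hxi' : 0 < s * D1 g xi y z).
    { apply Hs. destruct Hrho as [Hrho Hyz], Hx as [Hx _]. split; [|exact Hyz].
      revert Hxi. unfold Rmin, Rmax. destruct Rle_dec; lra. }
    rewrite H0, Rminus_0_r in Heq. rewrite Heq.
    (* Multiplying by s^2 groups the product as (s g') (s (x - rho)), which avoids distinguishing
       the sign of s. *)
    assert (Hs2 : 0 < s * s).
    { destruct (Req_dec s 0) as [-> |]; [lra | nra]. }
    assert (Hprod : s * s * (D1 g xi y z * (x - rho)) = (s * D1 g xi y z) * (s * (x - rho))) by ring.
    split; intros H.
    + apply (pos_factor (s * s)); [|exact Hs2]. rewrite Hprod. now apply Rmult_lt_0_compat.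
    + apply (Rmult_le_reg_l (s * s)); [exact Hs2 |]. rewrite Hprod, Rmult_0_r. nra.
Qed.

Lemma RInt_zero (f : R -> R) (a b : R) :
  (forall u, Rmin a b <= u <= Rmax a b -> f u = 0) -> RInt f a b = 0.
Proof.
  intros H. rewrite (RInt_ext f (fun _ => 0)).
  - rewrite RInt_const. apply Rmult_0_r.
  - intros u Hu. apply H. lra.
Qed.

Lemma between_side (s a rho u : R) :
  0 < s * (rho - a) -> Rmin a rho <= u <= Rmax a rho -> s * (u - rho) <= 0.
Proof.
  unfold Rmin, Rmax. intros H Hu. destruct Rle_dec.
  - assert (0 < s) by nra. nra.
  - assert (s < 0) by nra. nra.
Qed.

(** W is a boundary term g^(3/2) b plus the integral from [a] of g^(7/2) times a smooth factor,
    positive parts being understood. The integral is C^3 across the zero of g; the boundary term is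
    C^1 there and smooth where g > 0, whence the two regularity claims. At a zero rho with [a] on
    the side where g is negative, both terms and their parameter derivatives consist of half powers
    at arguments that are not positive. *)
Lemma action_near_zero (al be y0 z0 d s a : R) (g : R -> R -> R -> R) :
  let D := slab al be y0 z0 d in
  smooth_on D g -> (forall x y z, D x y z -> 0 < s * D1 g x y z) -> al < a < be ->
  exists W : R -> R -> R -> R,
    CkOn 1 D W /\ CkOn 3 (fun x y z => D x y z /\ 0 < g x y z) W /\
    (forall x y z, D x y z -> D1 W x y z = sqrt (g x y z)) /\
    (forall rho y z, D rho y z -> g rho y z = 0 -> 0 < s * (rho - a) ->
      D2 W rho y z = 0 /\ D3 W rho y z = 0).
Proof.
  intros D Hg Hs Ha.
  assert (HD : open3 D) by apply open3_slab.
  destruct (half_power_reduce D g 3 (fun _ _ _ => 1) HD Hg) as (b & rem & Hb & Hrem & Hder).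
  { intros x y z Hp H. specialize (Hs x y z Hp). rewrite H in Hs. lra. }
  { intros k. now apply CkOn_const. }
  set (F := fun x y z => half_power 3 (g x y z) * rem x y z).
  assert (HF : CkOn 3 D F).
  { apply CkOn_mult; auto. apply (CkOn_half_power 3 0); auto. }
  assert (HFcont : forall x y z, D x y z -> cont3 F x y z).
  { intros x y z Hp. apply (CkOn_cont 3 D F HF x y z Hp). }
  set (B := fun x y z => half_power 1 (g x y z) * b x y z).
  assert (HB : CkOn 1 D B).
  { apply CkOn_mult; auto. apply (CkOn_half_power 1 0); auto. }
  set (P := fun x y z => RInt (fun u => F u y z) a x).
  assert (HP : CkOn 3 D P) by (apply (CkOn_RInt al be y0 z0 d a Ha); auto).
  assert (HP1 := CkOn_3_1 D P HP). assert (HF1 := CkOn_3_1 D F HF).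
  exists (fun x y z => B x y z + P x y z).
  split; [|split; [|split; [|intros rho y z H H0 H1; split]]].
  - apply CkOn_plus; auto.
  - assert (HDp : open3 (fun x y z => D x y z /\ 0 < g x y z)).
    { apply open3_pos; auto. intros x y z Hp. apply (CkOn_cont 0 D g (Hg 0%nat) x y z Hp). }
    assert (Hsub : forall f, CkOn 3 D f -> CkOn 3 (fun x y z => D x y z /\ 0 < g x y z) f).
    { intros f. apply CkOn_sub. tauto. }
    apply CkOn_plus; auto. apply CkOn_mult; auto.
    apply (CkOn_mult 3 _ (fun x y z => g x y z ^ 1)); auto.
    + apply (CkOn_ext 3 _ g); auto. intros; ring.
    + apply CkOn_sqrt; auto. tauto.
  - intros x y z Hp. apply is_derive_unique.
    apply (is_derive_eq _ _ ((half_power 0 (g x y z) * 1 - half_power 3 (g x y z) * rem x y z)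
      + F x y z)).
    + apply is_derive_plus_R; [apply Hder, Hp |].
      apply (is_derive_RInt_slab al be y0 z0 d a Ha F); auto.
    + unfold F, half_power. ring.
  (* By monotonicity g <= 0 all the way from [a] to the zero, so the integrand and its parameter
     derivatives vanish identically on the path of integration. *)
  - assert (Hneg : forall u, Rmin a rho <= u <= Rmax a rho -> g u y z <= 0).
    { intros u Hu. apply (increasing_sign al be y0 z0 d s rho u y z g (Hg 1%nat) Hs); auto.
      - apply (slab_segment al be y0 z0 d a Ha rho y z u); auto.
      - eapply between_side; eauto. }
    apply is_derive_unique.
    apply (is_derive_eq _ _ (((INR 0 + 3 / 2) * half_power 0 (g rho y z) * D2 g rho y z * b rho y z
        + half_power 1 (g rho y z) * D2 b rho y z) + RInt (fun u => D2 F u y z) a rho)).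
    + apply is_derive_plus_R; [|apply (is_derive_RInt_slab2 al be y0 z0 d a Ha F); auto].
      apply (is_derive_mult_R (fun v => half_power 1 (g rho v z)) (fun v => b rho v z)).
      * apply (is_derive_comp_R (half_power 1)); [apply is_derive_half_power |].
        apply (CkOn_is_derive2 0 D g (Hg 1%nat)), H.
      * apply (CkOn_is_derive2 0 D b (Hb 1%nat)), H.
    + rewrite H0, !half_power_nonpos by lra. rewrite RInt_zero; [ring |].
      intros u Hu. assert (Hq := slab_segment al be y0 z0 d a Ha rho y z u H Hu).
      apply is_derive_unique. eapply is_derive_eq.
      * apply (is_derive_mult_R (fun v => half_power 3 (g u v z)) (fun v => rem u v z)).
        -- apply (is_derive_comp_R (half_power 3)); [apply is_derive_half_power |].
           apply (CkOn_is_derive2 0 D g (Hg 1%nat)), Hq.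
        -- apply (CkOn_is_derive2 0 D rem (Hrem 1%nat)), Hq.
      * rewrite !half_power_nonpos by auto. ring.
  - assert (Hneg : forall u, Rmin a rho <= u <= Rmax a rho -> g u y z <= 0).
    { intros u Hu. apply (increasing_sign al be y0 z0 d s rho u y z g (Hg 1%nat) Hs); auto.
      - apply (slab_segment al be y0 z0 d a Ha rho y z u); auto.
      - eapply between_side; eauto. }
    apply is_derive_unique.
    apply (is_derive_eq _ _ (((INR 0 + 3 / 2) * half_power 0 (g rho y z) * D3 g rho y z * b rho y z
        + half_power 1 (g rho y z) * D3 b rho y z) + RInt (fun u => D3 F u y z) a rho)).
    + apply is_derive_plus_R; [|apply (is_derive_RInt_slab3 al be y0 z0 d a Ha F); auto].
      apply (is_derive_mult_R (fun v => half_power 1 (g rho y v)) (fun v => b rho y v)).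
      * apply (is_derive_comp_R (half_power 1)); [apply is_derive_half_power |].
        apply (CkOn_is_derive3 0 D g (Hg 1%nat)), H.
      * apply (CkOn_is_derive3 0 D b (Hb 1%nat)), H.
    + rewrite H0, !half_power_nonpos by lra. rewrite RInt_zero; [ring |].
      intros u Hu. assert (Hq := slab_segment al be y0 z0 d a Ha rho y z u H Hu).
      apply is_derive_unique. eapply is_derive_eq.
      * apply (is_derive_mult_R (fun v => half_power 3 (g u y v)) (fun v => rem u y v)).
        -- apply (is_derive_comp_R (half_power 3)); [apply is_derive_half_power |].
           apply (CkOn_is_derive3 0 D g (Hg 1%nat)), Hq.
        -- apply (CkOn_is_derive3 0 D rem (Hrem 1%nat)), Hq.
      * rewrite !half_power_nonpos by auto. ring.
Qed.

(** Continuation of an action [A] beyond the radius [c], in a region where g > 0. The value of [A]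
    at [c] serves as a constant of integration depending on the parameters, so that both actions
    have the same parameter derivatives at [c]. Taking [A = 0] starts a new action at [c]. *)
Lemma action_away (al be y0 z0 d c : R) (g A : R -> R -> R -> R) :
  let D := slab al be y0 z0 d in
  smooth_on D g -> (forall x y z, D x y z -> 0 < g x y z) -> al < c < be ->
  CkOn 3 D (fun _ y z => A c y z) ->
  exists W : R -> R -> R -> R,
    CkOn 3 D W /\ (forall x y z, D x y z -> D1 W x y z = sqrt (g x y z)) /\
    (forall y z, D2 W c y z = D2 A c y z /\ D3 W c y z = D3 A c y z).
Proof.
  intros D Hg Hpos Hc HA.
  assert (HD : open3 D) by apply open3_slab.
  set (F := fun x y z => sqrt (g x y z)).
  assert (HF : CkOn 3 D F) by (apply CkOn_sqrt; auto).
  assert (HFcont : forall x y z, D x y z -> cont3 F x y z).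
  { intros x y z Hp. apply (CkOn_cont 3 D F HF x y z Hp). }
  exists (fun x y z => A c y z + RInt (fun u => F u y z) c x).
  split; [|split; [|intros y z; split]].
  - apply CkOn_plus; auto. apply (CkOn_RInt al be y0 z0 d c Hc); auto.
  - intros x y z Hp. apply is_derive_unique.
    apply (is_derive_eq _ _ (0 + F x y z)); [|apply Rplus_0_l].
    apply is_derive_plus_R; [apply is_derive_const_R |].
    apply (is_derive_RInt_slab al be y0 z0 d c Hc F); auto.
  - apply Derive_ext. intros v. rewrite RInt_point. apply Rplus_0_r.
  - apply Derive_ext. intros v. rewrite RInt_point. apply Rplus_0_r.
Qed.

(** Positivity survives on a slightly longer closed segment by continuity at its ends. The minimum
    of g there is a margin, and uniform continuity in the parameters keeps the change of g below
    this margin. *)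
Lemma positive_slab (u v y0 z0 : R) (g : R -> R -> R -> R) :
  u <= v ->
  (forall x, u <= x <= v -> 0 < g x y0 z0) ->
  (forall x, 0 < x -> cont3 g x y0 z0) -> 0 < u ->
  exists al be d, 0 < al < u /\ v < be /\ 0 < d /\
    forall x y z, slab al be y0 z0 d x y z -> 0 < g x y z.
Proof.
  intros Huv Hg Hcont Hu.
  assert (Hloc : forall w, u <= w <= v -> exists e : posreal, forall x,
    Rabs (x - w) < e -> 0 < g x y0 z0).
  { intros w Hw. assert (Hc : continuous (fun x => g x y0 z0) w).
    { apply (cont3_line1 g), Hcont. lra. }
    destruct (proj1 (filterlim_locally _ _) Hc (mkposreal _ (Hg w Hw))) as [e He].
    exists e. intros x Hx. specialize (He x Hx).
    change (Rabs (g x y0 z0 - g w y0 z0) < g w y0 z0) in He. apply Rabs_def2 in He. lra. }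
  destruct (Hloc u) as [eu Heu]; [lra |]. destruct (Hloc v) as [ev Hev]; [lra |].
  (* The bound u / 2 keeps radii positive; halving [eu] and [ev] leaves the closed segment inside
     the open neighbourhoods of [u] and [v] where g > 0. *)
  set (al := Rmax (u / 2) (u - eu / 2)). set (be := v + ev / 2).
  assert (Hal : 0 < al < u /\ u - eu < al).
  { unfold al. generalize (cond_pos eu) (Rmax_l (u / 2) (u - eu / 2))
      (Rmax_r (u / 2) (u - eu / 2)).
    assert (Rmax (u / 2) (u - eu / 2) < u); [|lra].
    apply Rmax_lub_lt; generalize (cond_pos eu); lra. }
  assert (Hbe : v < be /\ be < v + ev) by (unfold be; generalize (cond_pos ev); lra).
  assert (Hpos : forall x, al <= x <= be -> 0 < g x y0 z0).
  { intros x Hx. destruct (Rlt_le_dec x u).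
    - apply Heu, Rabs_def1; lra.
    - destruct (Rlt_le_dec v x).
      + apply Hev, Rabs_def1; lra.
      + apply Hg. lra. }
  destruct (continuity_ab_min (fun x => g x y0 z0) al be) as (xm & Hxm & Hxm'); [lra | |].
  { intros w Hw. apply continuity_pt_filterlim, (cont3_line1 g), Hcont. lra. }
  destruct (uniform_on_segment g al be y0 z0 (mkposreal _ (Hpos xm Hxm'))) as [d Hd].
  { intros w Hw. apply Hcont. lra. }
  exists al, be, d. split; [lra | split; [lra | split; [apply cond_pos |]]].
  intros x y z (Hx & Hy & Hz).
  assert (H1 := Hd x y z ltac:(lra) Hy Hz). simpl in H1.
  assert (H2 := Hxm x ltac:(lra)). apply Rabs_def2 in H1. lra.
Qed.

(** * Oriented integrals that are improper at the lower limit *)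

Lemma end_filter_side (s a b : R) (P : R -> Prop) :
  0 < s * (b - a) -> end_filter a b P <-> locally a (fun x => 0 < s * (x - a) -> P x).
Proof.
  intros Hs. unfold end_filter, at_right, at_left, within.
  destruct (Rlt_dec a b) as [Hab | Hab]; split; apply filter_imp; intros x HP Hx; apply HP;
    try (assert (0 < s) by nra); try (assert (s < 0) by nra); nra.
Qed.

Lemma end_filter_locally (a b : R) (P : R -> Prop) : locally a P -> end_filter a b P.
Proof.
  intros HP. unfold end_filter. destruct Rlt_dec; apply filter_le_within; exact HP.
Qed.

Global Instance end_filter_proper (a b : R) : ProperFilter' (end_filter a b).
Proof. unfold end_filter. destruct Rlt_dec; typeclasses eauto. Qed.

(** [F] acts as a primitive of [f] that vanishes at [a]. Only its continuity at [a] matters, so [f]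
    may blow up there; a regular lower limit is covered as well. *)
Lemma is_radial_int (f F : R -> R) (a b V : R) :
  end_filter a b (fun x => is_RInt f x b (V - F x)) ->
  continuous F a -> F a = 0 ->
  is_RInt_gen f (end_filter a b) (at_point b) V.
Proof.
  intros Hf Hc H0 P HP.
  assert (HPF : end_filter a b (fun x => P (V - F x))).
  { apply end_filter_locally.
    apply (continuous_minus (fun _ => V) F a); [apply continuous_const | exact Hc |].
    rewrite H0. change (minus V 0) with (V - 0). rewrite Rminus_0_r. exact HP. }
  assert (HF : Filter (end_filter a b)) by apply filter_filter'.
  apply (Filter_prod _ _ _ (fun x => is_RInt f x b (V - F x) /\ P (V - F x)) (fun x => x = b)).
  - now apply filter_and.
  - reflexivity.
  - intros x y [H1 H2] ->. exists (V - F x). auto.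
Qed.

(** * The radial action *)

(* The squared radial velocity, with [lam] standing for [L^2]: this makes it affine
   in both parameters and keeps the L-derivative usable at [L = 0]. *)
Definition radial_sq (U : R -> R) (ueq x lam e : R) : R :=
  2 * (e + ueq - U x) - lam / x ^ 2.

Lemma Rmin_Rmax_convex (r0 r tau : R) : 0 < tau <= / 2 ->
  Rmin r0 r <= r0 + tau * (r - r0) <= Rmax r0 r.
Proof. unfold Rmin, Rmax. intros H. destruct Rle_dec; split; nra. Qed.

Lemma Rmin_Rmax_convex_out (r0 r tau : R) : 0 < tau ->
  Rmin (r0 + tau * (r - r0)) r <= r0 <= Rmax (r0 + tau * (r - r0)) r -> r0 = r.
Proof.
  intros Htau. destruct (Rtotal_order r0 r) as [H | [H | H]]; [| auto |].
  - assert (0 < tau * (r - r0)) by (apply Rmult_lt_0_compat; lra).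
    unfold Rmin, Rmax. destruct Rle_dec; lra.
  - assert (0 < tau * (r0 - r)) by (apply Rmult_lt_0_compat; lra).
    unfold Rmin, Rmax. destruct Rle_dec; lra.
Qed.

Lemma same_side (s a u v w : R) : 0 < s * (u - a) -> 0 < s * (v - a) ->
  Rmin u v <= w <= Rmax u v -> 0 < s * (w - a).
Proof.
  unfold Rmin, Rmax. intros Hu Hv Hw.
  destruct (Rlt_le_dec 0 s); destruct Rle_dec; nra.
Qed.

Section RadialSquare.

Variables (U : R -> R) (ueq : R).
Hypothesis HU : smooth_potential U.
Let g : R -> R -> R -> R := radial_sq U ueq.

Lemma is_derive_radial_sq1 (x lam e : R) : 0 < x ->
  is_derive (fun u => g u lam e) x (- 2 * Derive U x + 2 * lam / x ^ 3).
Proof.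
  intros Hx. unfold g, radial_sq.
  assert (HUx : ex_derive U x) by apply (HU 1%nat x Hx).
  auto_derive; [repeat split; auto; nra |]. change (Derive (fun u => U u) x) with (Derive U x). field. lra.
Qed.

Lemma is_derive_radial_sq2 (x lam e : R) : 0 < x ->
  is_derive (fun u => g x u e) lam (- / x ^ 2).
Proof. intros Hx. unfold g, radial_sq. auto_derive; [nra |]. field. lra. Qed.

Lemma is_derive_radial_sq3 (x lam e : R) : is_derive (fun u => g x lam u) e 2.
Proof. unfold g, radial_sq. auto_derive; [auto |]. ring. Qed.

Lemma smooth_radial_sq (D : region) :
  open3 D -> (forall x y z, D x y z -> 0 < x) -> smooth_on D g.
Proof.
  intros HD Hpos k.
  apply (CkOn_ext k D (fun x y z => (2 * (z + (ueq + - 1 * Derive_n U 0 x))) + - 1 * (y * / (x * x)))).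
  - exact HD.
  - intros x y z Hp. specialize (Hpos x y z Hp). unfold g, radial_sq. simpl. field. lra.
  - apply CkOn_plus; auto.
    + apply CkOn_scal, CkOn_plus; auto; [now apply CkOn_coord3 |].
      apply CkOn_plus; auto; [now apply CkOn_const |].
      apply CkOn_scal; auto. now apply CkOn_Derive_n.
    + apply CkOn_scal, CkOn_mult; auto; [now apply CkOn_coord2 |].
      apply CkOn_inv; auto.
      * intros x y z Hp. specialize (Hpos x y z Hp). nra.
      * apply CkOn_mult; auto; now apply CkOn_coord1.
Qed.

Lemma cont3_radial_sq (x y z : R) : 0 < x -> cont3 g x y z.
Proof.
  intros Hx. apply (CkOn_cont 0 (fun x _ _ => 0 < x) g); auto.
  apply smooth_radial_sq; auto.
  intros u v w Hu. exists (mkposreal _ Hu). simpl. intros u' v' w' H _ _.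
  apply Rabs_def2 in H. lra.
Qed.

Section ActionDerivatives.

Variables (D : region) (W : R -> R -> R -> R).
Hypotheses (HD : open3 D) (Hpos : forall x y z, D x y z -> 0 < x)
  (Hg : forall x y z, D x y z -> 0 < g x y z) (HW : CkOn 3 D W)
  (HW1 : forall x y z, D x y z -> D1 W x y z = sqrt (g x y z)).

Let HW2 : CkOn 2 D W := CkOn_pred 2 D W HW.

(** Differentiate W_x = sqrt(g) in the energy and exchange the two derivatives; g_E = 2 cancels the
    factor 2 of the square root. *)
Lemma is_derive_action_energy (x y z : R) : D x y z ->
  is_derive (fun u => D3 W u y z) x (/ sqrt (g x y z)).
Proof.
  intros Hp. assert (Hs := sqrt_lt_R0 _ (Hg x y z Hp)).
  apply (is_derive_eq _ _ (D1 (D3 W) x y z)).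
  { apply (CkOn_is_derive1 1 D (D3 W)); auto. now apply CkOn_D3. }
  rewrite (Schwarz13 D W HD HW2 x y z Hp).
  destruct (D_ext D (D1 W) (fun x y z => sqrt (g x y z)) x y z HD Hp HW1) as (_ & _ & ->).
  apply is_derive_unique. apply (is_derive_eq _ _ (/ (2 * sqrt (g x y z)) * 2)); [|field; lra].
  apply (is_derive_comp_R sqrt); [|apply is_derive_radial_sq3].
  specialize (Hg x y z Hp). auto_derive; auto. ring.
Qed.

(** The same exchange with g_lam = -1 / x^2, which is where the factor -2 originates. *)
Lemma is_derive_action_momentum (x y z : R) : D x y z ->
  is_derive (fun u => - 2 * D2 W u y z) x (/ (x ^ 2 * sqrt (g x y z))).
Proof.
  intros Hp. assert (Hs := sqrt_lt_R0 _ (Hg x y z Hp)). assert (Hx := Hpos x y z Hp).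
  apply (is_derive_eq _ _ (- 2 * D1 (D2 W) x y z)).
  { apply (is_derive_scal (fun u => D2 W u y z)).
    apply (CkOn_is_derive1 1 D (D2 W)); auto. now apply CkOn_D2. }
  rewrite (Schwarz12 D W HD HW2 x y z Hp).
  destruct (D_ext D (D1 W) (fun x y z => sqrt (g x y z)) x y z HD Hp HW1) as (_ & -> & _).
  replace (D2 (fun x y z => sqrt (g x y z)) x y z) with (/ (2 * sqrt (g x y z)) * (- / x ^ 2));
    [field; lra |].
  symmetry. apply is_derive_unique.
  apply (is_derive_comp_R sqrt); [|now apply is_derive_radial_sq2].
  specialize (Hg x y z Hp). auto_derive; auto. ring.
Qed.

Lemma is_RInt_action (u v y z : R) :
  (forall x, Rmin u v <= x <= Rmax u v -> D x y z) ->
  is_RInt (fun x => / sqrt (g x y z)) u v (D3 W v y z - D3 W u y z) /\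
  is_RInt (fun x => / (x ^ 2 * sqrt (g x y z))) u v (- 2 * D2 W v y z - - 2 * D2 W u y z).
Proof.
  intros H.
  assert (Hc : forall x, Rmin u v <= x <= Rmax u v -> continuous (fun x => sqrt (g x y z)) x).
  { intros x Hx. apply (continuous_comp (fun x => g x y z) sqrt); [|apply continuous_sqrt].
    apply (cont3_line1 g), cont3_radial_sq, (Hpos x y z), H, Hx. }
  assert (Hn : forall x, Rmin u v <= x <= Rmax u v -> 0 < x /\ 0 < sqrt (g x y z)).
  { intros x Hx. split; [apply (Hpos x y z), H, Hx | apply sqrt_lt_R0, Hg, H, Hx]. }
  split.
  - apply (is_RInt_derive (V := R_CompleteNormedModule) (fun x => D3 W x y z)).
    + intros x Hx. apply is_derive_action_energy, H, Hx.
    + intros x Hx. destruct (Hn x Hx).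
      apply (continuous_comp (fun x => sqrt (g x y z)) Rinv); [auto | apply continuous_Rinv; lra].
  - apply (is_RInt_derive (V := R_CompleteNormedModule) (fun x => - 2 * D2 W x y z)).
    + intros x Hx. apply is_derive_action_momentum, H, Hx.
    + intros x Hx. destruct (Hn x Hx).
      apply (continuous_comp (fun x => x ^ 2 * sqrt (g x y z)) Rinv).
      * apply (continuous_mult (fun x => x ^ 2)); auto.
        apply (ex_derive_continuous (fun x => x ^ 2)). auto_derive. auto.
      * apply continuous_Rinv. apply Rgt_not_eq, Rmult_lt_0_compat; [nra | lra].
Qed.

End ActionDerivatives.

(* [base x y z] holds of the admissible lower limits [x] at the parameters [(y, z)]. *)
Definition radial_action (W : R -> R -> R -> R) (base : region) (r y0 z0 d : R) : Prop :=
  let D := slab (r - d) (r + d) y0 z0 d in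
  0 < d /\ CkOn 3 D W /\
  (forall x y z, D x y z -> 0 < x /\ 0 < g x y z /\ D1 W x y z = sqrt (g x y z)) /\
  (forall x y z rho, D x y z -> base rho y z ->
    is_RInt_gen (fun u => / sqrt (g u y z)) (end_filter rho x) (at_point x) (D3 W x y z) /\
    is_RInt_gen (fun u => / (u ^ 2 * sqrt (g u y z))) (end_filter rho x) (at_point x)
      (- 2 * D2 W x y z)).

Lemma D23_const_zero (x y z : R) : D2 (fun _ _ _ => 0) x y z = 0 /\ D3 (fun _ _ _ => 0) x y z = 0.
Proof. split; apply is_derive_unique, is_derive_const_R. Qed.

(** As g > 0 on the closed segment, the integral of sqrt(g) started at [r0] is itself C^3. Its lower
    limit does not depend on the parameters, so its parameter derivatives vanish at [r0], as the
    integrals require. *)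
Lemma radial_action_fixed (r0 r y0 z0 : R) :
  0 < r0 -> 0 < r -> (forall x, Rmin r0 r <= x <= Rmax r0 r -> 0 < g x y0 z0) ->
  exists W d, radial_action W (fun x _ _ => x = r0) r y0 z0 d.
Proof.
  intros Hr0 Hr Hpos.
  destruct (positive_slab (Rmin r0 r) (Rmax r0 r) y0 z0 g) as (al & be & d & Hal & Hbe & Hd & Hg).
  { eapply Rle_trans; [apply Rmin_l | apply Rmax_l]. }
  { exact Hpos. }
  { intros x Hx. now apply cont3_radial_sq. }
  { now apply Rmin_pos. }
  set (D := slab al be y0 z0 d).
  assert (HD : open3 D) by apply open3_slab.
  assert (HDpos : forall x y z, D x y z -> 0 < x) by (intros x y z [Hx _]; lra).
  assert (Hminmax := conj (conj (Rmin_l r0 r) (Rmin_r r0 r)) (conj (Rmax_l r0 r) (Rmax_r r0 r))).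
  assert (Hc : al < r0 < be) by lra.
  destruct (action_away al be y0 z0 d r0 g (fun _ _ _ => 0)) as (W & HW & HW1 & HWc).
  { now apply smooth_radial_sq. }
  { exact Hg. }
  { exact Hc. }
  { apply (CkOn_const 3 _ 0 HD). }
  set (d' := Rmin d (Rmin (r - al) (be - r))).
  assert (Hd' : 0 < d' /\ d' <= d /\ d' <= r - al /\ d' <= be - r).
  { unfold d'. generalize (Rmin_l d (Rmin (r - al) (be - r))) (Rmin_r d (Rmin (r - al) (be - r)))
      (Rmin_l (r - al) (be - r)) (Rmin_r (r - al) (be - r)).
    repeat split; try lra. repeat apply Rmin_pos; lra. }
  assert (Hsub : forall x y z, slab (r - d') (r + d') y0 z0 d' x y z -> D x y z).
  { intros x y z (Hx & Hy & Hz). repeat split; lra. }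
  exists W, d'. split; [lra | split; [|split]].
  - now apply (CkOn_sub 3 D).
  - intros x y z Hp. apply Hsub in Hp.
    split; [now apply (HDpos x y z) | split; [now apply Hg | now apply HW1]].
  - intros x y z rho Hp ->. apply Hsub in Hp.
    assert (Hp0 : D r0 y z) by (destruct Hp as [_ Hp]; now split).
    assert (Hnear : end_filter r0 x (fun u => forall w, Rmin u x <= w <= Rmax u x -> D w y z)).
    { apply end_filter_locally.
      destruct (open3_lines D r0 y z HD Hp0) as (HL & _ & _). revert HL. apply filter_imp.
      intros u [Hu Hyz] w Hw. destruct Hp as [Hx _]. split; [|exact Hyz].
      revert Hw. unfold Rmin, Rmax. destruct Rle_dec; lra. }
    destruct (HWc y z) as [HWc2 HWc3]. destruct (D23_const_zero r0 y z) as [Z2 Z3].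
    rewrite Z2 in HWc2. rewrite Z3 in HWc3.
    split.
    + apply (is_radial_int _ (fun u => D3 W u y z)); [|apply (cont3_line1 (D3 W)) | exact HWc3].
      * apply (filter_imp _ _ (fun u Hu =>
          proj1 (is_RInt_action D W HD HDpos Hg HW HW1 u x y z Hu)) Hnear).
      * apply (CkOn_cont 2 D); [now apply CkOn_D3 | exact Hp0].
    + apply (is_radial_int _ (fun u => - 2 * D2 W u y z)).
      * apply (filter_imp _ _ (fun u Hu =>
          proj2 (is_RInt_action D W HD HDpos Hg HW HW1 u x y z Hu)) Hnear).
      * apply (continuous_scal_r (- 2) (fun u => D2 W u y z)), (cont3_line1 (D2 W)).
        apply (CkOn_cont 2 D); [now apply CkOn_D2 | exact Hp0].
      * rewrite HWc2. apply Rmult_0_r.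
Qed.

(** A box around a simple zero in which g' keeps its sign, expressed through a product to treat both
    signs together. The bound by r0 / 2 keeps the box at positive radii. *)
Lemma slope_box (r0 y0 z0 : R) : 0 < r0 -> D1 g r0 y0 z0 <> 0 ->
  exists eta, 0 < eta <= r0 / 2 /\ forall x y z, slab (r0 - eta) (r0 + eta) y0 z0 eta x y z ->
    0 < D1 g r0 y0 z0 * D1 g x y z.
Proof.
  intros Hr0 Hn.
  set (Dp := (fun x _ _ => 0 < x) : region).
  assert (HDp : open3 Dp).
  { intros u v w Hu. exists (mkposreal _ Hu). simpl. intros u' v' w' H _ _.
    unfold Dp. apply Rabs_def2 in H. lra. }
  assert (Hg1 : CkOn 0 Dp (fun x y z => D1 g r0 y0 z0 * D1 g x y z)).
  { apply CkOn_scal; auto. apply CkOn_D1. apply smooth_radial_sq; auto. }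
  destruct (open3_pos Dp _ HDp (CkOn_cont 0 _ _ Hg1) r0 y0 z0) as [e He].
  { split; [exact Hr0 |]. nra. }
  exists (Rmin e (r0 / 2)). split.
  - generalize (Rmin_r e (r0 / 2)) (Rmin_pos e (r0 / 2) (cond_pos e)). lra.
  - intros x y z (Hx & Hy & Hz). generalize (Rmin_l e (r0 / 2)). intros Hm.
    apply He; [apply Rabs_def1 | |]; lra.
Qed.

(** Two actions are glued at a radius r1 close to r0 on the side of r: one adapted to the zero,
    living where g' has constant sign, and its continuation, living where g > 0. For neighbouring
    parameters the zero rho has moved, but it stays between the fixed starting point [a] and r1. *)
Lemma radial_action_turning (r0 r y0 z0 : R) :
  0 < r0 -> 0 < r -> r0 <> r -> g r0 y0 z0 = 0 -> D1 g r0 y0 z0 <> 0 ->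
  (forall x, Rmin r0 r <= x <= Rmax r0 r -> x <> r0 -> 0 < g x y0 z0) ->
  exists W d, radial_action W (fun x y z => Rabs (x - r0) < d /\ g x y z = 0) r y0 z0 d.
Proof.
  intros Hr0 Hr Hne Hg0 Hn Hpos.
  destruct (slope_box r0 y0 z0 Hr0 Hn) as (eta & Heta & Hslope).
  set (s := r - r0).
  assert (Hs : s <> 0) by (unfold s; lra).
  assert (Hs2 : 0 < s * s) by nra.
  assert (Habs : 0 < Rabs s) by now apply Rabs_pos_lt.
  (* The bound 1/2 puts r0 + tau s between r0 and r; the other bound keeps r0 + tau s and r0 - tau s
     inside the box of half-width eta. *)
  set (tau := Rmin (/ 2) (eta / (2 * Rabs s))).
  assert (Htau : 0 < tau <= / 2 /\ tau * Rabs s <= eta / 2).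
  { unfold tau. split; [split |].
    - apply Rmin_pos; [lra |]. apply Rdiv_lt_0_compat; lra.
    - apply Rmin_l.
    - replace (eta / 2) with (eta / (2 * Rabs s) * Rabs s) by (field; lra).
      apply Rmult_le_compat_r; [lra | apply Rmin_r]. }
  set (kap := tau * Rabs s).
  assert (Hkap : 0 < kap) by (apply Rmult_lt_0_compat; lra).
  (* [kap] is the drift allowed to the zero: within this distance of r0 it remains strictly between
     r0 - tau s and r0 + tau s, read in the direction of s. *)
  assert (Hside : forall u v, Rabs (u - r0) < kap -> v = r0 + tau * s ->
    0 < s * (v - u) /\ 0 < s * (u - (r0 - tau * s))).
  { intros u v Hu ->. unfold kap in Hu. apply Rabs_def2 in Hu.
    destruct (Rle_dec 0 s) as [Hle | Hle].
    - rewrite Rabs_pos_eq in Hu by lra. split; apply Rmult_lt_0_compat; lra.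
    - rewrite Rabs_left in Hu by lra. split; nra. }
  set (r1 := r0 + tau * s). set (a := r0 - tau * s).
  assert (Hts : Rabs (tau * s) = kap) by (rewrite Rabs_mult, (Rabs_pos_eq tau); [reflexivity | lra]).
  assert (Hts' : - kap <= tau * s <= kap) by (apply Rabs_le_between; lra).
  assert (Hkeq : kap = tau * Rabs s) by reflexivity.
  set (al := r0 - eta). set (be := r0 + eta).
  assert (Hr0' : al < r0 < be /\ 0 < al) by (unfold al, be; lra).
  set (D := slab al be y0 z0 eta).
  assert (HD : open3 D) by apply open3_slab.
  assert (HDpos : forall x y z, D x y z -> 0 < x) by (intros x y z [Hx _]; unfold al in Hx; lra).
  assert (Hsm : smooth_on D g) by now apply smooth_radial_sq.
  assert (Hcenter : forall x, al < x < be -> D x y0 z0).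
  { intros x Hx. repeat split; try tauto; rewrite Rminus_eq_0, Rabs_R0; lra. }
  assert (Hr1 : al < r1 < be) by (unfold r1, al, be; lra).
  assert (Ha : al < a < be) by (unfold a, al, be; lra).
  assert (Hr1' : Rmin r0 r <= r1 <= Rmax r0 r).
  { unfold r1, s. now apply Rmin_Rmax_convex. }
  assert (Hr1ne : r1 <> r0).
  { unfold r1. intros H. apply Hs. apply (Rmult_eq_reg_l tau); lra. }
  (* Since g vanishes at r0 and is positive at r1, the mean value theorem makes s g' positive at
     some intermediate point, and g' has the same sign at r0. *)
  assert (Hs1 : 0 < s * D1 g r0 y0 z0).
  { destruct (MVT_gen (fun u => g u y0 z0) r0 r1 (fun u => D1 g u y0 z0)) as (xi & Hxi & Heq).
    - intros u Hu. apply (CkOn_is_derive1 0 D g (Hsm 1%nat)), Hcenter.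
      revert Hu. unfold Rmin, Rmax. destruct Rle_dec; lra.
    - intros u Hu. apply continuity_pt_filterlim, (cont3_line1 g), cont3_radial_sq.
      revert Hu. unfold Rmin, Rmax. destruct Rle_dec; lra.
    - assert (Hxi' : 0 < D1 g r0 y0 z0 * D1 g xi y0 z0).
      { apply Hslope, Hcenter. revert Hxi. unfold Rmin, Rmax. destruct Rle_dec; lra. }
      assert (H1 := Hpos r1 Hr1' Hr1ne).
      rewrite Hg0, Rminus_0_r in Heq. unfold r1 at 2 in Heq.
      replace (D1 g xi y0 z0 * (r0 + tau * s - r0)) with (tau * (s * D1 g xi y0 z0)) in Heq by ring.
      rewrite Heq in H1. apply (pos_factor tau) in H1; [|lra].
      apply (pos_factor (D1 g xi y0 z0 * D1 g xi y0 z0)).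
      + replace (D1 g xi y0 z0 * D1 g xi y0 z0 * (s * D1 g r0 y0 z0))
          with ((D1 g r0 y0 z0 * D1 g xi y0 z0) * (s * D1 g xi y0 z0)) by ring.
        now apply Rmult_lt_0_compat.
      + nra. }
  assert (Hmono : forall x y z, D x y z -> 0 < s * D1 g x y z).
  { intros x y z Hp. apply (pos_factor (D1 g r0 y0 z0 * D1 g r0 y0 z0)).
    - replace (D1 g r0 y0 z0 * D1 g r0 y0 z0 * (s * D1 g x y z))
        with ((s * D1 g r0 y0 z0) * (D1 g r0 y0 z0 * D1 g x y z)) by ring.
      apply Rmult_lt_0_compat; auto.
    - nra. }
  destruct (action_near_zero al be y0 z0 eta s a g Hsm Hmono Ha) as (Wn & HWn & HWn3 & HWn1 & HWn0).
  set (Dp := (fun x y z => D x y z /\ 0 < g x y z) : region).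
  assert (HDp : open3 Dp).
  { apply open3_pos; auto. intros x y z Hp. apply (CkOn_cont 0 D g (Hsm 0%nat) x y z Hp). }
  destruct (positive_slab (Rmin r1 r) (Rmax r1 r) y0 z0 g) as (al' & be' & d & Hal' & Hbe' & Hd & Hg).
  { eapply Rle_trans; [apply Rmin_l | apply Rmax_l]. }
  { intros x Hx. apply Hpos.
    - revert Hx Hr1'. clear. unfold Rmin, Rmax. do 2 destruct Rle_dec; lra.
    - intros ->. apply Hne, (Rmin_Rmax_convex_out r0 r tau); [lra | exact Hx]. }
  { intros x Hx. now apply cont3_radial_sq. }
  { apply Rmin_pos; [unfold al in Hr1; lra | exact Hr]. }
  assert (Hminmax := conj (conj (Rmin_l r1 r) (Rmin_r r1 r)) (conj (Rmax_l r1 r) (Rmax_r r1 r))).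
  set (d2 := Rmin d eta).
  assert (Hd2 : 0 < d2 /\ d2 <= d /\ d2 <= eta).
  { split; [apply Rmin_pos; lra | split; [apply Rmin_l | apply Rmin_r]]. }
  set (S := slab al' be' y0 z0 d2).
  assert (HS : open3 S) by apply open3_slab.
  assert (HSpos : forall x y z, S x y z -> 0 < x) by (intros x y z [Hx _]; lra).
  assert (HSg : forall x y z, S x y z -> 0 < g x y z).
  { intros x y z (Hx & Hy & Hz). apply Hg. repeat split; lra. }
  assert (HSm : smooth_on S g) by now apply smooth_radial_sq.
  assert (Hc : al' < r1 < be') by lra.
  (* The constant of integration is the slice of [Wn] at r1. There g > 0, so this slice is C^3
     although [Wn] itself is only known to be C^1 across the zero. *)
  destruct (action_away al' be' y0 z0 d2 r1 g Wn HSm HSg Hc) as (W & HW & HW1 & HWc).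
  { apply (CkOn_fix1 3 Dp S r1 Wn HS); [|exact HWn3].
    intros x y z (Hx & Hy & Hz). split; [repeat split; lra |].
    apply HSg. repeat split; lra. }
  (* The bound by [kap] keeps the moving zero between [a] and r1, the bound by |r - r1| keeps the
     upper limit x beyond r1, and the remaining ones keep the slab around r inside [S]. *)
  set (d' := Rmin (Rmin d2 kap) (Rmin (Rmin (r - al') (be' - r)) (Rabs (r - r1)))).
  assert (Hrr1 : r - r1 = (1 - tau) * s) by (unfold r1, s; ring).
  assert (Hd' : 0 < d' /\ d' <= d2 /\ d' <= kap /\ d' <= r - al' /\ d' <= be' - r
    /\ d' <= Rabs (r - r1)).
  { assert (Hrr : 0 < Rabs (r - r1)) by (rewrite Hrr1; apply Rabs_pos_lt; nra).
    unfold d'.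
    set (u := Rmin d2 kap). set (w := Rmin (r - al') (be' - r)).
    generalize (Rmin_l u (Rmin w (Rabs (r - r1)))) (Rmin_r u (Rmin w (Rabs (r - r1))))
      (Rmin_l w (Rabs (r - r1))) (Rmin_r w (Rabs (r - r1)))
      (Rmin_l d2 kap) (Rmin_r d2 kap) (Rmin_l (r - al') (be' - r)) (Rmin_r (r - al') (be' - r)).
    fold u w. repeat split; try lra.
    repeat apply Rmin_pos; lra. }
  assert (Hsub : forall x y z, slab (r - d') (r + d') y0 z0 d' x y z -> S x y z).
  { intros x y z (Hx & Hy & Hz). repeat split; lra. }
  exists W, d'. split; [lra | split; [|split]].
  - now apply (CkOn_sub 3 S).
  - intros x y z Hp. apply Hsub in Hp.
    split; [now apply (HSpos x y z) | split; [now apply HSg | now apply HW1]].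
  - intros x y z rho Hp [Hrho Hrho0].
    assert (Hxr1 : 0 < s * (x - r1)).
    { destruct Hp as [Hx _].
      assert (H : d' <= (1 - tau) * Rabs s).
      { rewrite <- (Rabs_pos_eq (1 - tau)), <- Rabs_mult, <- Hrr1; lra. }
      replace (x - r1) with ((x - r) + (1 - tau) * s) by lra.
      destruct (Rle_dec 0 s).
      - rewrite Rabs_pos_eq in H by lra. apply Rmult_lt_0_compat; lra.
      - rewrite Rabs_left in H by lra. nra. }
    apply Hsub in Hp.
    destruct (Hside rho r1) as [Hrho1 Hrhoa]; [lra | reflexivity |].
    assert (Hrhox : 0 < s * (x - rho)) by lra.
    assert (HDrho : D rho y z).
    { destruct Hp as [_ [Hy Hz]]. apply Rabs_def2 in Hrho. repeat split; unfold al, be; lra. }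
    (* For u close to rho on the side of x, monotonicity gives g > 0 on the whole segment from u to
       r1, so the ordinary fundamental theorem of calculus applies to [Wn] there. *)
    assert (Hnear : end_filter rho x (fun u => forall w, Rmin u r1 <= w <= Rmax u r1 -> Dp w y z)).
    { apply (end_filter_side s); [exact Hrhox |].
      destruct (open3_lines D rho y z HD HDrho) as (HL & _ & _). revert HL. apply filter_imp.
      intros u HDu Hu w Hw.
      assert (HDw : D w y z).
      { destruct HDu as [Hu' Hyz]. split; [|exact Hyz].
        revert Hw. unfold Rmin, Rmax. destruct Rle_dec; lra. }
      split; [exact HDw |].
      apply (increasing_sign al be y0 z0 eta s rho w y z g (Hsm 1%nat) Hmono); auto.
      now apply (same_side s rho u r1 w). }
    assert (Hfar : forall w, Rmin r1 x <= w <= Rmax r1 x -> S w y z).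
    { intros w Hw. destruct Hp as [Hx Hyz]. split; [|exact Hyz].
      revert Hw. unfold Rmin, Rmax. destruct Rle_dec; lra. }
    destruct (HWc y z) as [HWc2 HWc3].
    destruct (HWn0 rho y z HDrho Hrho0 Hrhoa) as [Z2 Z3].
    assert (HDpD : forall x y z, Dp x y z -> D x y z) by (intros u v w [H _]; exact H).
    assert (Hn1 : forall x y z, Dp x y z -> D1 Wn x y z = sqrt (g x y z)).
    { intros u v w [H _]. apply HWn1, H. }
    assert (Hnpos : forall x y z, Dp x y z -> 0 < x) by (intros u v w [H _]; eapply HDpos, H).
    assert (Hng : forall x y z, Dp x y z -> 0 < g x y z) by (intros u v w [_ H]; exact H).
    destruct (is_RInt_action S W HS HSpos HSg HW HW1 r1 x y z Hfar) as [F3 F2].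
    split.
    + apply (is_radial_int _ (fun u => D3 Wn u y z)); [|apply (cont3_line1 (D3 Wn)) | exact Z3].
      * revert Hnear. apply filter_imp. intros u Hu.
        destruct (is_RInt_action Dp Wn HDp Hnpos Hng HWn3 Hn1 u r1 y z Hu) as [N3 _].
        (* The path from u to x is cut at r1, where the parameter derivatives of [Wn] and [W] agree
           and therefore cancel. *)
        replace (D3 W x y z - D3 Wn u y z)
          with ((D3 Wn r1 y z - D3 Wn u y z) + (D3 W x y z - D3 W r1 y z)).
        -- exact (is_RInt_Chasles (V := R_NormedModule) _ u r1 x _ _ N3 F3).
        -- rewrite HWc3. ring.
      * apply (CkOn_cont 0 D); [now apply CkOn_D3 | exact HDrho].
    + apply (is_radial_int _ (fun u => - 2 * D2 Wn u y z)).
      * revert Hnear. apply filter_imp. intros u Hu.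
        destruct (is_RInt_action Dp Wn HDp Hnpos Hng HWn3 Hn1 u r1 y z Hu) as [_ N2].
        replace (- 2 * D2 W x y z - - 2 * D2 Wn u y z)
          with ((- 2 * D2 Wn r1 y z - - 2 * D2 Wn u y z)
            + (- 2 * D2 W x y z - - 2 * D2 W r1 y z)).
        -- exact (is_RInt_Chasles (V := R_NormedModule) _ u r1 x _ _ N2 F2).
        -- rewrite HWc2. ring.
      * apply (continuous_scal_r (- 2) (fun u => D2 Wn u y z)), (cont3_line1 (D2 Wn)).
        apply (CkOn_cont 0 D); [now apply CkOn_D2 | exact HDrho].
      * rewrite Z2. apply Rmult_0_r.
Qed.

End RadialSquare.

(** * Trajectories *)

Lemma is_derive_zero_const (f : R -> R) (a b s t : R) :
  (forall u, a < u < b -> is_derive f u 0) -> a < s < b -> a < t < b -> f s = f t.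
Proof.
  intros Hf Hs Ht. destruct (MVT_gen f s t (fun _ => 0)) as (c & _ & Hc).
  - intros u Hu. apply Hf. revert Hu. unfold Rmin, Rmax. destruct Rle_dec; lra.
  - intros u Hu. apply continuity_pt_filterlim, (ex_derive_continuous f). exists 0. apply Hf.
    revert Hu. unfold Rmin, Rmax. destruct Rle_dec; lra.
  - lra.
Qed.

(** Gronwall argument: f^2 times a decaying exponential does not increase from p towards q. It
    starts at 0 and is nonnegative, so f vanishes at q. *)
Lemma linear_growth_zero (f df : R -> R) (M p q : R) :
  (forall s, Rmin p q <= s <= Rmax p q -> is_derive f s (df s) /\ Rabs (df s) <= M * Rabs (f s)) ->
  f p = 0 -> f q = 0.
Proof.
  intros Hf Hp.
  (* [k] records the direction of time, so that the exponential decays from p to q also when q <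
     p. *)
  set (k := if Rle_dec p q then 1 else - 1).
  set (e := fun s => f s * f s * exp (- 2 * M * k * s)).
  destruct (MVT_gen e p q
    (fun s => (2 * f s * df s - 2 * M * k * (f s * f s)) * exp (- 2 * M * k * s)))
    as (c & Hc & Heq).
  1, 2: assert (He : forall s, Rmin p q <= s <= Rmax p q -> is_derive e s
    ((2 * f s * df s - 2 * M * k * (f s * f s)) * exp (- 2 * M * k * s)));
    [intros s Hs; eapply is_derive_eq;
      [apply (is_derive_mult_R (fun s => f s * f s) (fun s => exp (- 2 * M * k * s)));
        [apply (is_derive_mult_R f f); apply Hf, Hs | auto_derive; [auto | reflexivity]]
      | ring] |].
  - intros s Hs. apply He. lra.
  - intros s Hs. apply continuity_pt_filterlim, (ex_derive_continuous e). eexists. apply He, Hs.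
  - destruct (Hf c Hc) as [_ HB].
    assert (HE := exp_pos (- 2 * M * k * c)). assert (HQ := exp_pos (- 2 * M * k * q)).
    assert (H1 : Rabs (f c * df c) <= M * (f c * f c)).
    { rewrite Rabs_mult, <- (Rabs_pos_eq (f c * f c)), Rabs_mult by nra.
      generalize (Rabs_pos (f c)). nra. }
    apply Rabs_le_between in H1.
    assert (H2 : (2 * f c * df c - 2 * M * k * (f c * f c)) * (q - p) <= 0).
    { unfold k. destruct Rle_dec; nra. }
    unfold e in Heq. rewrite Hp in Heq.
    assert (H3 : f q * f q * exp (- 2 * M * k * q) <= 0).
    { replace (f q * f q * exp (- 2 * M * k * q)) with
        ((2 * f c * df c - 2 * M * k * (f c * f c)) * (q - p) * exp (- 2 * M * k * c)) by lra.
      nra. }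
    assert (H4 : f q * f q <= 0) by nra.
    nra.
Qed.

Lemma intermediate_value (f : R -> R) (p q y : R) :
  (forall s, Rmin p q <= s <= Rmax p q -> continuity_pt f s) ->
  Rmin (f p) (f q) <= y <= Rmax (f p) (f q) ->
  exists s, Rmin p q <= s <= Rmax p q /\ f s = y.
Proof.
  assert (Hle : forall f p q, p <= q -> (forall s, p <= s <= q -> continuity_pt f s) ->
    f p <= y <= f q \/ f q <= y <= f p -> exists s, p <= s <= q /\ f s = y).
  { clear. intros f p q [Hpq | ->] Hc Hy.
    - destruct Hy as [Hy | Hy].
      + destruct (f_interv_is_interv f p q y Hpq Hy Hc) as (s & Hs & Hfs). eauto.
      + destruct (f_interv_is_interv (fun s => - f s) p q (- y) Hpq) as (s & Hs & Hfs).
        * lra.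
        * intros s Hs. apply continuity_pt_opp, Hc, Hs.
        * exists s. split; [exact Hs | lra].
    - exists q. split; lra. }
  intros Hc Hy. unfold Rmin, Rmax in Hc |- *.
  assert (Hy' : f p <= y <= f q \/ f q <= y <= f p).
  { revert Hy. unfold Rmin, Rmax. destruct (Rle_dec (f p) (f q)); intros Hy; [left | right]; lra. }
  destruct (Rle_dec p q) as [Hpq | Hpq].
  - now apply Hle.
  - apply Hle; [lra | exact Hc | tauto].
Qed.

Section Trajectory.

Variables (U : R -> R) (ueq : R).
Hypothesis HU : smooth_potential U.

(** With C the maximum of |g''| on [m, M], the mean value inequality bounds g' by C |x - x0|, and a
    second use bounds g by C (x - x0)^2. *)
Lemma radial_sq_quadratic (m M x0 lam e : R) :
  0 < m -> m <= x0 <= M -> radial_sq U ueq x0 lam e = 0 ->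
  D1 (radial_sq U ueq) x0 lam e = 0 ->
  exists C, 0 <= C /\ forall x, m <= x <= M -> Rabs (radial_sq U ueq x lam e) <= C * (x - x0) ^ 2.
Proof.
  intros Hm Hx0 Hg0 Hg1. set (g := radial_sq U ueq).
  set (Dp := (fun x _ _ => 0 < x) : region).
  assert (HDp : open3 Dp).
  { intros u v w Hu. exists (mkposreal _ Hu). simpl. intros u' v' w' H _ _.
    unfold Dp. apply Rabs_def2 in H. lra. }
  assert (Hg : smooth_on Dp g) by now apply smooth_radial_sq.
  assert (H1 : forall x, m <= x <= M -> is_derive (fun u => g u lam e) x (D1 g x lam e)).
  { intros x Hx. apply (CkOn_is_derive1 0 Dp g (Hg 1%nat)). unfold Dp. lra. }
  assert (H2 : forall x, m <= x <= M -> is_derive (fun u => D1 g u lam e) x (D1 (D1 g) x lam e)).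
  { intros x Hx. apply (CkOn_is_derive1 0 Dp (D1 g)); [apply CkOn_D1, Hg | unfold Dp; lra]. }
  destruct (continuity_ab_maj (fun x => Rabs (D1 (D1 g) x lam e)) m M) as (xm & Hxm & _); [lra | |].
  { intros x Hx. apply continuity_pt_filterlim.
    apply (continuous_comp (fun x => D1 (D1 g) x lam e) Rabs); [|apply continuous_Rabs].
    apply (cont3_line1 (D1 (D1 g))), (CkOn_cont 0 Dp); [|unfold Dp; lra].
    apply CkOn_D1, CkOn_D1, Hg. }
  set (C := Rabs (D1 (D1 g) xm lam e)). exists C. split; [apply Rabs_pos |].
  intros x Hx.
  assert (Hseg : forall w u, m <= w <= M -> Rmin x0 w <= u <= Rmax x0 w -> m <= u <= M).
  { intros w u Hw. unfold Rmin, Rmax. destruct Rle_dec; lra. }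
  assert (B1 : forall u, m <= u <= M -> Rabs (D1 g u lam e) <= C * Rabs (u - x0)).
  { intros u Hu. replace (D1 g u lam e) with (D1 g u lam e - D1 g x0 lam e - 0 * (u - x0)).
    - apply (increment_bound (fun u => D1 g u lam e) (fun u => D1 (D1 g) u lam e)).
      intros w Hw. assert (Hw' := Hseg u w Hu Hw). split; [now apply H2 |].
      rewrite Rminus_0_r. now apply Hxm.
    - unfold g. rewrite Hg1. ring. }
  rewrite <- (Rabs_pos_eq ((x - x0) ^ 2)) by apply pow2_ge_0.
  replace (C * Rabs ((x - x0) ^ 2)) with ((C * Rabs (x - x0)) * Rabs (x - x0))
    by (simpl; rewrite Rmult_1_r, Rabs_mult; ring).
  fold g. replace (g x lam e) with (g x lam e - g x0 lam e - 0 * (x - x0)).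
  - apply (increment_bound (fun u => g u lam e) (fun u => D1 g u lam e)).
    intros w Hw. assert (Hw' := Hseg x w Hx Hw). split; [now apply H1 |].
    rewrite Rminus_0_r. eapply Rle_trans; [apply B1, Hw' |].
    apply Rmult_le_compat_l; [apply Rabs_pos | now apply Rabs_between].
  - unfold g. rewrite Hg0. ring.
Qed.

Variables (t r th v om rho : R).
Hypotheses (Hr : 0 < r) (Hv : v <> 0) (Htraj : on_trajectory U t r th v om rho).
Let lam := (fi_L t r th v om) ^ 2.
Let en := fi_E U ueq t r th v om.
Let g (x : R) := radial_sq U ueq x lam en.

Lemma radial_sq_state : g r = v ^ 2.
Proof. unfold g, radial_sq, lam, en, fi_E, fi_L. field. lra. Qed.

(* If [g] had a double zero at a radius [x] on the trajectory then
   |dr/dt| <= C |r - x|, and the trajectory would stay at [r = x]. *)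
Lemma radial_sq_trajectory :
  0 < rho /\
  (forall x, Rmin rho r <= x <= Rmax rho r -> 0 <= g x) /\
  (forall x, Rmin rho r <= x <= Rmax rho r -> g x = 0 -> D1 (radial_sq U ueq) x lam en <> 0).
Proof.
  destruct Htraj as (a & b & rad & ang & vel & avel & Hab & Hsol & Er & _ & Ev & Eom & s1 & Hs1 & Es1).
  assert (HL : forall s, a < s < b -> avel s * rad s ^ 2 = fi_L t r th v om).
  { intros s Hs. unfold fi_L. rewrite <- Er, <- Eom.
    apply (is_derive_zero_const (fun s => avel s * rad s ^ 2) a b); auto.
    intros u Hu. destruct (Hsol u Hu) as (P & D1' & _ & _ & D4).
    eapply is_derive_eq.
    - apply (is_derive_mult_R avel (fun s => rad s ^ 2)); [exact D4 |].
      apply (is_derive_comp_R (fun x => x ^ 2) rad _ (2 * rad u)); [|exact D1'].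
      auto_derive; auto; ring.
    - field. lra. }
  assert (HE : forall s, a < s < b -> vel s ^ 2 = g (rad s)).
  { intros s Hs. cut (vel s ^ 2 - g (rad s) = vel t ^ 2 - g (rad t)).
    - rewrite Er, Ev, radial_sq_state. lra.
    - apply (is_derive_zero_const (fun s => vel s ^ 2 - g (rad s)) a b); auto.
      intros u Hu. destruct (Hsol u Hu) as (P & D1' & _ & D3' & _). specialize (HL u Hu).
      eapply is_derive_eq.
      + apply (is_derive_plus_R (fun s => vel s ^ 2) (fun s => - g (rad s))).
        * apply (is_derive_comp_R (fun x => x ^ 2) vel _ (2 * vel u)); [|exact D3'].
          auto_derive; auto; ring.
        * apply (is_derive_opp (fun s => g (rad s))).
          apply (is_derive_comp_R g rad); [|exact D1']. now apply is_derive_radial_sq1.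
      + change opp with Ropp. unfold lam. rewrite <- HL. field. lra. }
  assert (Hseg : forall p q s, a < p < b -> a < q < b -> Rmin p q <= s <= Rmax p q -> a < s < b).
  { intros p q s Hp Hq. unfold Rmin, Rmax. destruct Rle_dec; lra. }
  assert (Hcont : forall s, a < s < b -> continuity_pt rad s).
  { intros s Hs. apply continuity_pt_filterlim, (ex_derive_continuous rad).
    eexists. apply (Hsol s Hs). }
  (* By the intermediate value theorem the motion passes through every radius between rho and r, so
     g equals a squared velocity at each of them. *)
  assert (Hatt : forall x, Rmin rho r <= x <= Rmax rho r -> exists s, a < s < b /\ rad s = x).
  { intros x Hx. destruct (intermediate_value rad s1 t x) as (s & Hs & Hxs).
    - intros s Hs. apply Hcont. eauto.
    - now rewrite Er, Es1.
    - exists s. eauto. }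
  split; [|split].
  - rewrite <- Es1. apply (Hsol s1 Hs1).
  - intros x Hx. destruct (Hatt x Hx) as (s & Hs & <-). rewrite <- HE by exact Hs.
    apply pow2_ge_0.
  - intros x Hx Hg0 Hg1. destruct (Hatt x Hx) as (s & Hs & Hrs).
    (* The radii attained between the times s and t fill a compact interval inside r > 0, on which
       the quadratic bound for g is uniform. *)
    destruct (continuity_ab_maj rad (Rmin s t) (Rmax s t)) as (sM & HsM & HsM').
    { eapply Rle_trans; [apply Rmin_l | apply Rmax_l]. }
    { intros w Hw. apply Hcont. eauto. }
    destruct (continuity_ab_min rad (Rmin s t) (Rmax s t)) as (sm & Hsm & Hsm').
    { eapply Rle_trans; [apply Rmin_l | apply Rmax_l]. }
    { intros w Hw. apply Hcont. eauto. }
    destruct (radial_sq_quadratic (rad sm) (rad sM) x lam en) as (C & HC0 & HC); auto.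
    { apply (Hsol sm). eauto. }
    { rewrite <- Hrs. split; [apply Hsm | apply HsM]; split; auto using Rmin_l, Rmax_l. }
    (* From vel^2 <= C (rad - x)^2 one gets |vel| <= (1 + C) |rad - x|, because C <= (1 + C)^2.
       Hence the radius is still x at time t, and v^2 = g(x) = 0 contradicts v <> 0. *)
    assert (Hz : rad t - x = 0).
    { apply (linear_growth_zero (fun w => rad w - x) vel (1 + C) s t); [|lra].
      intros w Hw. assert (Hw' : a < w < b) by eauto. split.
      - apply (is_derive_eq _ _ (vel w + 0)); [|ring].
        apply (is_derive_plus_R rad (fun _ => - x)); [apply (Hsol w Hw') | apply is_derive_const_R].
      - apply Rsqr_incr_0.
        + rewrite Rsqr_mult, <- !Rsqr_abs. unfold Rsqr.
          assert (H1 := HC (rad w) (conj (Hsm w Hw) (HsM w Hw))). fold (g (rad w)) in H1.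
          rewrite <- HE in H1 by exact Hw'. rewrite Rabs_pos_eq in H1 by apply pow2_ge_0.
          assert (H2 : 0 <= (rad w - x) * (rad w - x)) by apply Rle_0_sqr.
          replace (vel w * vel w) with (vel w ^ 2) by ring.
          eapply Rle_trans; [exact H1 |].
          replace ((rad w - x) ^ 2) with ((rad w - x) * (rad w - x)) by ring.
          apply Rmult_le_compat_r; [exact H2 |]. clear - HC0. nra.
        + apply Rabs_pos.
        + apply Rmult_le_pos; [lra | apply Rabs_pos]. }
    assert (H := HE t Hab). rewrite Ev in H.
    replace (rad t) with x in H by lra. rewrite Hg0 in H.
    apply Hv. apply Rsqr_0_uniq. unfold Rsqr. lra.
Qed.

(** At the end r the value is v^2 > 0. A zero strictly between rho and r would be an interior
    minimum of a nonnegative function, so g' would vanish there too, and double zeros on the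
    trajectory are excluded. *)
Lemma radial_sq_pos (x : R) : Rmin rho r <= x <= Rmax rho r -> x <> rho -> 0 < g x.
Proof.
  intros Hx Hne. destruct radial_sq_trajectory as (Hrho & Hge & Hdeg).
  destruct (Req_dec x r) as [-> | Hxr].
  { rewrite radial_sq_state. nra. }
  destruct (Hge x Hx) as [H | H]; [exact H | exfalso].
  apply (Hdeg x Hx); [now symmetry |].
  assert (Hx0 : 0 < x).
  { apply Rlt_le_trans with (2 := proj1 Hx). now apply Rmin_pos. }
  assert (Hd : derivable_pt g x).
  { exists (- 2 * Derive U x + 2 * lam / x ^ 3). apply is_derive_Reals.
    now apply is_derive_radial_sq1. }
  assert (Hd0 : derive_pt g x Hd = 0).
  { apply (deriv_minimum g (Rmin rho r) (Rmax rho r) x Hd).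
    - revert Hx. unfold Rmin, Rmax. destruct Rle_dec; lra.
    - revert Hx. unfold Rmin, Rmax. destruct Rle_dec; lra.
    - intros w Hw1 Hw2. rewrite <- H. apply Hge. lra. }
  rewrite <- Hd0. symmetry. apply (Derive_Reals g x Hd).
Qed.

End Trajectory.

(** * The action as a generating function *)

Lemma Theta_integrand_radial_sq (U : R -> R) (ueq sg l e x : R) : 0 < x ->
  Theta_integrand U ueq sg l e x = sg * / (x ^ 2 * sqrt (radial_sq U ueq x (l ^ 2) e)).
Proof.
  intros Hx. unfold Theta_integrand, Rdiv. do 2 f_equal.
  replace (2 * (e + ueq - U x) * x ^ 4 - l ^ 2 * x ^ 2)
    with ((x ^ 2 * x ^ 2) * radial_sq U ueq x (l ^ 2) e)
    by (unfold radial_sq; field; lra).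
  rewrite sqrt_mult_alt by (apply Rmult_le_pos; apply pow2_ge_0).
  now rewrite sqrt_square by apply pow2_ge_0.
Qed.

Lemma is_RInt_gen_Theta (U : R -> R) (ueq sg l e a b V : R) : 0 < a -> 0 < b ->
  is_RInt_gen (fun u => / (u ^ 2 * sqrt (radial_sq U ueq u (l ^ 2) e))) (end_filter a b) (at_point b) V ->
  is_RInt_gen (Theta_integrand U ueq sg l e) (end_filter a b) (at_point b) (sg * V).
Proof.
  intros Ha Hb H.
  assert (HF : Filter (end_filter a b)) by apply filter_filter'.
  apply (is_RInt_gen_ext
    (fun u => scal sg (/ (u ^ 2 * sqrt (radial_sq U ueq u (l ^ 2) e))))).
  - apply (Filter_prod _ _ _ (fun x => 0 < x) (fun x => x = b)).
    + apply end_filter_locally, (open_gt 0 a Ha).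
    + reflexivity.
    + intros x y Hx -> u [Hu _]. simpl in Hu. symmetry. apply Theta_integrand_radial_sq.
      eapply Rlt_trans; [|exact Hu]. now apply Rmin_pos.
  - now apply (is_RInt_gen_scal (V := R_NormedModule)).
Qed.

Lemma is_RInt_gen_T (U : R -> R) (ueq sg l e a b V : R) :
  is_RInt_gen (fun u => / sqrt (radial_sq U ueq u (l ^ 2) e)) (end_filter a b) (at_point b) V ->
  is_RInt_gen (T_integrand U ueq sg l e) (end_filter a b) (at_point b) (sg * V).
Proof.
  intros H. assert (HF : Filter (end_filter a b)) by apply filter_filter'.
  exact (is_RInt_gen_scal (V := R_NormedModule) _ sg _ H).
Qed.

(* [V] is the radial action, through which Theta = theta + sg V_L and T = t - sg V_E. *)
Definition generates_Theta_T (U : R -> R) (ueq : R) (r0 : R -> R -> R) (V : R -> R -> R -> R)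
    (r L E d : R) : Prop :=
  let B := slab (r - d) (r + d) L E d in
  0 < d /\ CkOn 3 B V /\
  forall x l e, B x l e ->
    0 < x /\ 0 < radial_sq U ueq x (l ^ 2) e /\
    D1 V x l e = sqrt (radial_sq U ueq x (l ^ 2) e) /\
    forall sg,
      ex_radial_int (Theta_integrand U ueq sg l e) (r0 l e) x /\
      ex_radial_int (T_integrand U ueq sg l e) (r0 l e) x /\
      (forall th, Theta_LE U ueq r0 sg x th l e = th + sg * D2 V x l e) /\
      (forall t, T_LE U ueq r0 sg t x l e = t - sg * D3 V x l e).

(** V(x, L, E) = W(x, L^2, E), so V_L = 2 L W_lam. The integral in Theta equals -2 sgn(v) W_lam, and
    its prefactor L completes the expression to V_L without any division by L. *)
Lemma generates_of_radial_action (U : R -> R) (ueq : R) (r0 : R -> R -> R)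
    (W : R -> R -> R -> R) (base : region) (r L E d : R) :
  radial_action U ueq W base r (L ^ 2) E d ->
  locally_2d (fun l e => 0 < r0 l e /\ base (r0 l e) (l ^ 2) e) L E ->
  exists V d', generates_Theta_T U ueq r0 V r L E d'.
Proof.
  intros (Hd & HW & HW1 & HWi) [db Hb].
  assert (HL2 : continuous (fun l : R => l ^ 2) L).
  { apply (ex_derive_continuous (fun l : R => l ^ 2)). auto_derive. exact I. }
  destruct (proj1 (filterlim_locally _ _) HL2 (mkposreal d Hd)) as [dl Hl].
  set (d' := Rmin d (Rmin db dl)).
  assert (Hd' : 0 < d' /\ d' <= d /\ d' <= db /\ d' <= dl).
  { unfold d'. generalize (Rmin_l d (Rmin db dl)) (Rmin_r d (Rmin db dl)) (Rmin_l db dl) (Rmin_r db dl).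
    repeat split; try lra. repeat apply Rmin_pos; try apply cond_pos; lra. }
  set (B := slab (r - d') (r + d') L E d').
  assert (HB : open3 B) by apply open3_slab.
  assert (Hsub : forall x l e, B x l e -> slab (r - d) (r + d) (L ^ 2) E d x (l ^ 2) e).
  { intros x l e (Hx & Hy & Hz). split; [lra | split; [|lra]]. apply Hl.
    change (Rabs (l - L) < dl). lra. }
  exists (fun x l e => W x (l ^ 2) e), d'. split; [lra | split].
  - now apply (CkOn_square2 3 (slab (r - d) (r + d) (L ^ 2) E d)).
  - intros x l e Hp. assert (Hq := Hsub x l e Hp). destruct (HW1 _ _ _ Hq) as (Hx & Hg & H1).
    destruct (Hb l e) as [Hrho Hbase]; [destruct Hp as (_ & Hy & Hz); lra .. |].
    destruct (HWi x (l ^ 2) e (r0 l e) Hq Hbase) as [HT HTh].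
    split; [exact Hx | split; [exact Hg | split; [exact H1 |]]].
    intros sg.
    assert (ITh := is_RInt_gen_Theta U ueq sg l e _ _ _ Hrho Hx HTh).
    assert (IT := is_RInt_gen_T U ueq sg l e _ _ _ HT).
    split; [eexists; exact ITh | split; [eexists; exact IT | split]].
    + intros th. unfold Theta_LE, radial_int. rewrite (is_RInt_gen_unique _ _ ITh).
      replace (D2 (fun x l e => W x (l ^ 2) e) x l e) with (D2 W x (l ^ 2) e * (2 * l)); [ring |].
      symmetry. apply is_derive_unique.
      apply (is_derive_comp_R (fun u => W x u e) (fun l => l ^ 2)).
      * apply (CkOn_is_derive2 2 _ W HW _ _ _ Hq).
      * auto_derive; [auto | ring].
    + intros t. unfold T_LE, radial_int. rewrite (is_RInt_gen_unique _ _ IT). reflexivity.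
Qed.

Lemma base_point_generates (U : R -> R) (ueq : R) (r0 : R -> R -> R) (t r th v om : R) :
  smooth_potential U -> 0 < r -> v <> 0 -> base_point U ueq r0 t r th v om ->
  exists V d, generates_Theta_T U ueq r0 V r (fi_L t r th v om) (fi_E U ueq t r th v om) d.
Proof.
  intros HU Hr Hv [Htraj Hbase].
  set (L := fi_L t r th v om) in *. set (E := fi_E U ueq t r th v om) in *.
  destruct (radial_sq_trajectory U ueq HU t r th v om (r0 L E) Hr Hv Htraj) as (Hrho & Hge & Hdeg).
  assert (Hgpos := radial_sq_pos U ueq HU t r th v om (r0 L E) Hr Hv Htraj).
  assert (Hstate := radial_sq_state U ueq t r th v om Hr).
  fold L E in Hge, Hdeg, Hgpos, Hstate.
  assert (Hin : Rmin (r0 L E) r <= r0 L E <= Rmax (r0 L E) r) by (split; [apply Rmin_l | apply Rmax_l]).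
  assert (HUeff : forall rs l e, 0 < rs -> Ueff U ueq l rs = e -> radial_sq U ueq rs (l ^ 2) e = 0).
  { intros rs l e Hrs <-. unfold radial_sq, Ueff. field. lra. }
  destruct Hbase as [[Hturn Hcont] | [[_ Hin0] Hfix]].
  - fold L E in Hturn, Hcont.
    assert (Hg0 : radial_sq U ueq (r0 L E) (L ^ 2) E = 0).
    { destruct (locally_2d_singleton _ _ _ Hturn) as [_ H]. now apply HUeff. }
    destruct (radial_action_turning U ueq HU (r0 L E) r (L ^ 2) E) as (W & d & HW); auto.
    { intros Heq. rewrite Heq, Hstate in Hg0. nra. }
    apply (generates_of_radial_action _ _ _ _ _ _ _ _ _ HW).
    assert (Hd : 0 < d) by apply HW.
    generalize (locally_2d_and _ _ _ _ Hturn (Hcont (mkposreal d Hd))).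
    (* Continuity of the branch is used here only to keep the moving turning point inside the ball
       in which the action was built. *)
    apply locally_2d_impl, locally_2d_forall. intros l e [[H1 H2] H3]. auto.
  - fold L E in Hin0, Hfix.
    assert (Hg0 : 0 < radial_sq U ueq (r0 L E) (L ^ 2) E).
    (* If g vanished at the inertial point, then g' = -2 Ueff' = 0 would make the zero double, which
       the trajectory rules out. *)
    { destruct (Hge _ Hin) as [H | H]; [exact H | exfalso].
      apply (Hdeg _ Hin); [now symmetry |]. unfold D1.
      rewrite (Derive_ext_loc _ (fun u => 2 * E - 2 * Ueff U ueq L u)).
      - assert (Hex : ex_derive (Ueff U ueq L) (r0 L E)).
        { unfold Ueff. assert (HUr : ex_derive U (r0 L E)) by apply (HU 1%nat _ Hrho).
          auto_derive. repeat split; auto. nra. }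
        apply is_derive_unique. apply (is_derive_eq _ _ (0 + - 2 * Derive (Ueff U ueq L) (r0 L E))).
        + apply (is_derive_ext_R (fun u => 2 * E + - 2 * Ueff U ueq L u)); [intros; ring |].
          apply (is_derive_plus_R (fun _ => 2 * E)); [apply is_derive_const_R |].
          apply (is_derive_scal (Ueff U ueq L)), Derive_correct, Hex.
        + rewrite Hin0. ring.
      - generalize (open_gt 0 (r0 L E) Hrho). apply filter_imp. intros u Hu.
        unfold radial_sq, Ueff. field. lra. }
    destruct (radial_action_fixed U ueq HU (r0 L E) r (L ^ 2) E Hrho Hr) as (W & d & HW).
    { intros x Hx. destruct (Req_dec x (r0 L E)) as [-> | Hne]; [exact Hg0 | now apply Hgpos]. }
    apply (generates_of_radial_action _ _ _ _ _ _ _ _ _ HW).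
    revert Hfix. apply locally_2d_impl, locally_2d_forall. intros l e ->. auto.
Qed.

Section SpeedDerivatives.

Variables (U : R -> R) (ueq : R) (r0 : R -> R -> R) (V : R -> R -> R -> R) (r L E d : R).
Hypothesis HV : generates_Theta_T U ueq r0 V r L E d.
Let B := slab (r - d) (r + d) L E d.
Let S (x l e : R) := sqrt (radial_sq U ueq x (l ^ 2) e).

Lemma slab_center : B r L E.
Proof.
  destruct HV as [Hd _]. unfold B, slab. rewrite !Rminus_eq_0, Rabs_R0. lra.
Qed.

Lemma speed_pos (x l e : R) : B x l e -> 0 < x /\ 0 < S x l e.
Proof.
  intros Hp. destruct HV as (_ & _ & H). destruct (H x l e Hp) as (Hx & Hg & _).
  split; [exact Hx | apply sqrt_lt_R0, Hg].
Qed.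

Lemma is_derive_speed2 (x l e : R) : B x l e ->
  is_derive (fun u => S x u e) l (- l / (x ^ 2 * S x l e)).
Proof.
  intros Hp. destruct (speed_pos x l e Hp) as [Hx HS].
  destruct HV as (_ & _ & H). destruct (H x l e Hp) as (_ & Hg & _).
  apply (is_derive_eq _ _ (/ (2 * S x l e) * (- / x ^ 2 * (2 * l)))); [|field; lra].
  apply (is_derive_comp_R sqrt (fun u => radial_sq U ueq x (u ^ 2) e)).
  - auto_derive; [exact Hg | unfold S; ring].
  - apply (is_derive_comp_R (fun u => radial_sq U ueq x u e) (fun u => u ^ 2)).
    + now apply is_derive_radial_sq2.
    + auto_derive; [auto | ring].
Qed.

Lemma is_derive_speed3 (x l e : R) : B x l e -> is_derive (fun u => S x l u) e (/ S x l e).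
Proof.
  intros Hp. destruct (speed_pos x l e Hp) as [Hx HS].
  destruct HV as (_ & _ & H). destruct (H x l e Hp) as (_ & Hg & _).
  apply (is_derive_eq _ _ (/ (2 * S x l e) * 2)); [|field; lra].
  apply (is_derive_comp_R sqrt (fun u => radial_sq U ueq x (l ^ 2) u)).
  - auto_derive; [exact Hg | unfold S; ring].
  - apply is_derive_radial_sq3.
Qed.

Let HB : open3 B := open3_slab _ _ _ _ _.

Lemma action_mixed_first (x l e : R) : B x l e ->
  D1 (D2 V) x l e = - l / (x ^ 2 * S x l e) /\ D1 (D3 V) x l e = / S x l e.
Proof.
  intros Hp. destruct HV as (_ & H3 & H).
  assert (H2 := CkOn_pred _ _ _ H3). fold B in H, H2.
  assert (HD : forall a b c, B a b c -> D1 V a b c = S a b c) by (intros a b c Ha; apply (H a b c Ha)).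
  destruct (D_ext B (D1 V) S x l e HB Hp HD) as (_ & E2 & E3).
  rewrite (Schwarz12 B V HB H2), (Schwarz13 B V HB H2), E2, E3 by exact Hp.
  split; apply is_derive_unique; [now apply is_derive_speed2 | now apply is_derive_speed3].
Qed.

(** The radial derivatives of the second parameter derivatives of V. They are what the total time
    derivatives of the components of [X_Theta] and [X_T] involve, and Schwarz's theorem turns them
    into parameter derivatives of the speed. *)
Lemma action_mixed_second (x l e : R) : B x l e ->
  D1 (D2 (D2 V)) x l e = - / (x ^ 2 * S x l e) - l ^ 2 / (x ^ 4 * S x l e ^ 3) /\
  D1 (D3 (D2 V)) x l e = l / (x ^ 2 * S x l e ^ 3) /\
  D1 (D2 (D3 V)) x l e = l / (x ^ 2 * S x l e ^ 3) /\
  D1 (D3 (D3 V)) x l e = - / S x l e ^ 3.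
Proof.
  intros Hp. destruct HV as (_ & H3 & _).
  assert (HV2 : CkOn 2 B (D2 V)) by now apply CkOn_D2.
  assert (HV3 : CkOn 2 B (D3 V)) by now apply CkOn_D3.
  destruct (speed_pos x l e Hp) as [Hx HS].
  assert (I2 := is_derive_speed2 x l e Hp). assert (I3 := is_derive_speed3 x l e Hp).
  destruct (D_ext B (D1 (D2 V)) (fun x l e => - l / (x ^ 2 * S x l e)) x l e HB Hp) as (_ & E22 & E23).
  { intros a b c Ha. now apply action_mixed_first. }
  destruct (D_ext B (D1 (D3 V)) (fun x l e => / S x l e) x l e HB Hp) as (_ & E32 & E33).
  { intros a b c Ha. now apply action_mixed_first. }
  rewrite (Schwarz12 B (D2 V) HB HV2), (Schwarz13 B (D2 V) HB HV2), (Schwarz12 B (D3 V) HB HV3),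
    (Schwarz13 B (D3 V) HB HV3), E22, E23, E32, E33 by exact Hp.
  assert (Hinv : is_derive Rinv (S x l e) (- / S x l e ^ 2)).
  { auto_derive; [lra | field; lra]. }
  assert (J2 : is_derive (fun u => / S x u e) l (- / S x l e ^ 2 * (- l / (x ^ 2 * S x l e)))).
  { now apply (is_derive_comp_R Rinv (fun u => S x u e)). }
  assert (J3 : is_derive (fun u => / S x l u) e (- / S x l e ^ 2 * / S x l e)).
  { now apply (is_derive_comp_R Rinv (fun u => S x l u)). }
  assert (Hnear : locally l (fun u => 0 < S x u e) /\ locally e (fun u => 0 < S x l u)).
  { destruct (open3_lines B x l e HB Hp) as (_ & L2 & L3). split.
    - revert L2. apply filter_imp. intros u Hu. now apply speed_pos.
    - revert L3. apply filter_imp. intros u Hu. now apply speed_pos. }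
  destruct Hnear as [N2 N3].
  repeat split; apply is_derive_unique.
  - apply (is_derive_ext_loc (fun u => (- / x ^ 2 * u) * / S x u e)).
    { revert N2. apply filter_imp. intros u Hu.
      change (- / x ^ 2 * u * / S x u e = - u / (x ^ 2 * S x u e)). field. lra. }
    eapply is_derive_eq.
    + apply (is_derive_mult_R (fun u => - / x ^ 2 * u)); [|exact J2].
      apply (is_derive_scal (fun u => u) l (- / x ^ 2) 1), (is_derive_id l).
    + cbv beta. field. lra.
  - apply (is_derive_ext_loc (fun u => (- l / x ^ 2) * / S x l u)).
    { revert N3. apply filter_imp. intros u Hu.
      change (- l / x ^ 2 * / S x l u = - l / (x ^ 2 * S x l u)). field. lra. }
    eapply is_derive_eq.
    + apply (is_derive_scal (fun u => / S x l u)). exact J3.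
    + cbv beta. field. lra.
  - eapply is_derive_eq; [exact J2 | field; lra].
  - eapply is_derive_eq; [exact J3 | field; lra].
Qed.

End SpeedDerivatives.

(** * Gradients on phase space *)

Ltac split5 := split; [|split; [|split; [|split]]].

Section PhaseSpace.

Variables (t r th v om : R).

Definition gradient (F : phase_fun) (ft fr fth fv fom : R) : Prop :=
  is_derive (fun x => F x r th v om) t ft /\
  is_derive (fun x => F t x th v om) r fr /\
  is_derive (fun x => F t r x v om) th fth /\
  is_derive (fun x => F t r th x om) v fv /\
  is_derive (fun x => F t r th v x) om fom.

(** Partial derivatives see a function only along the five coordinate lines through the state, so
    agreement along these lines is enough to transport a gradient. *)
Definition on_lines (P : R -> R -> R -> R -> R -> Prop) : Prop :=
  locally t (fun x => P x r th v om) /\ locally r (fun x => P t x th v om) /\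
  locally th (fun x => P t r x v om) /\ locally v (fun x => P t r th x om) /\
  locally om (fun x => P t r th v x).

Lemma gradient_ext (F G : phase_fun) (ft fr fth fv fom : R) :
  on_lines (fun t r th v om => F t r th v om = G t r th v om) ->
  gradient F ft fr fth fv fom -> gradient G ft fr fth fv fom.
Proof.
  intros (E1 & E2 & E3 & E4 & E5) (H1 & H2 & H3 & H4 & H5).
  split5.
  - exact (is_derive_ext_loc _ _ _ _ E1 H1).
  - exact (is_derive_ext_loc _ _ _ _ E2 H2).
  - exact (is_derive_ext_loc _ _ _ _ E3 H3).
  - exact (is_derive_ext_loc _ _ _ _ E4 H4).
  - exact (is_derive_ext_loc _ _ _ _ E5 H5).
Qed.

Lemma gradient_has_partials (F : phase_fun) (ft fr fth fv fom : R) :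
  gradient F ft fr fth fv fom -> has_partials F t r th v om.
Proof. intros (H1 & H2 & H3 & H4 & H5). split5; eexists; eauto. Qed.

Lemma gradient_values (F : phase_fun) (ft fr fth fv fom : R) :
  gradient F ft fr fth fv fom ->
  d_t F t r th v om = ft /\ d_r F t r th v om = fr /\ d_th F t r th v om = fth /\
  d_v F t r th v om = fv /\ d_om F t r th v om = fom.
Proof.
  intros (H1 & H2 & H3 & H4 & H5). split5; now apply is_derive_unique.
Qed.

Lemma gradient_plus (F G : phase_fun) (ft fr fth fv fom gt gr gth gv gom : R) :
  gradient F ft fr fth fv fom -> gradient G gt gr gth gv gom ->
  gradient (fun t r th v om => F t r th v om + G t r th v om)
    (ft + gt) (fr + gr) (fth + gth) (fv + gv) (fom + gom).
Proof.
  intros (H1 & H2 & H3 & H4 & H5) (K1 & K2 & K3 & K4 & K5).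
  split5; now apply is_derive_plus_R.
Qed.

Lemma gradient_mult (F G : phase_fun) (ft fr fth fv fom gt gr gth gv gom : R) :
  gradient F ft fr fth fv fom -> gradient G gt gr gth gv gom ->
  gradient (fun t r th v om => F t r th v om * G t r th v om)
    (ft * G t r th v om + F t r th v om * gt) (fr * G t r th v om + F t r th v om * gr)
    (fth * G t r th v om + F t r th v om * gth) (fv * G t r th v om + F t r th v om * gv)
    (fom * G t r th v om + F t r th v om * gom).
Proof.
  intros (H1 & H2 & H3 & H4 & H5) (K1 & K2 & K3 & K4 & K5).
  split5.
  - exact (is_derive_mult_R (fun x => F x r th v om) (fun x => G x r th v om) _ _ _ H1 K1).
  - exact (is_derive_mult_R (fun x => F t x th v om) (fun x => G t x th v om) _ _ _ H2 K2).
  - exact (is_derive_mult_R (fun x => F t r x v om) (fun x => G t r x v om) _ _ _ H3 K3).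
  - exact (is_derive_mult_R (fun x => F t r th x om) (fun x => G t r th x om) _ _ _ H4 K4).
  - exact (is_derive_mult_R (fun x => F t r th v x) (fun x => G t r th v x) _ _ _ H5 K5).
Qed.

Lemma gradient_cst (c : R) : gradient (cst c) 0 0 0 0 0.
Proof. split5; exact (is_derive_const_R c _). Qed.

Lemma gradient_t : gradient (fun t _ _ _ _ => t) 1 0 0 0 0.
Proof. split5; solve [exact (is_derive_const_R t _) | exact (is_derive_id t)]. Qed.

Lemma gradient_th : gradient (fun _ _ th _ _ => th) 0 0 1 0 0.
Proof. split5; solve [exact (is_derive_const_R th _) | exact (is_derive_id th)]. Qed.

Lemma gradient_v : gradient (fun _ _ _ v _ => v) 0 0 0 1 0.
Proof. split5; solve [exact (is_derive_const_R v _) | exact (is_derive_id v)]. Qed.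

Lemma gradient_om : gradient (fun _ _ _ _ om => om) 0 0 0 0 1.
Proof. split5; solve [exact (is_derive_const_R om _) | exact (is_derive_id om)]. Qed.

Variables (U : R -> R).

Definition Dt_of_gradient (ft fr fth fv fom : R) : R :=
  ft + v * fr + om * fth + (om ^ 2 * r - Derive U r) * fv - 2 * om * v / r * fom.

Lemma Dt_gradient (F : phase_fun) (ft fr fth fv fom : R) :
  gradient F ft fr fth fv fom -> Dt U F t r th v om = Dt_of_gradient ft fr fth fv fom.
Proof.
  intros HF. unfold Dt. destruct (gradient_values _ _ _ _ _ _ HF) as (-> & -> & -> & -> & ->).
  reflexivity.
Qed.

Lemma first_integral_of_gradient (F : phase_fun) (ft fr fth fv fom : R) :
  gradient F ft fr fth fv fom -> Dt_of_gradient ft fr fth fv fom = 0 ->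
  first_integral_at U F t r th v om.
Proof.
  intros HF H0. split; [eapply gradient_has_partials, HF |]. now rewrite (Dt_gradient _ _ _ _ _ _ HF).
Qed.

(** For xi = 0 the transport terms -tau dr/dt, -tau dtheta/dt and the accelerations in D_t P^r, D_t
    P^theta cancel against tau D_t F. What remains is the usual first prolongation tau F_t + psi
    F_theta - v (D_t tau) F_v + (D_t psi - omega D_t tau) F_omega. *)
Lemma pr_acts_of_gradient (tau psi F : phase_fun)
    (at_ ar ath av aom bt br bth bv bom ft fr fth fv fom c : R) :
  r <> 0 ->
  gradient tau at_ ar ath av aom -> gradient psi bt br bth bv bom ->
  gradient F ft fr fth fv fom ->
  tau t r th v om * ft + psi t r th v om * fth
    - v * Dt_of_gradient at_ ar ath av aom * fv
    + (Dt_of_gradient bt br bth bv bom - om * Dt_of_gradient at_ ar ath av aom) * fom = c ->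
  pr_acts U (Generator tau (cst 0) psi) F c t r th v om.
Proof.
  intros Hr Ha Hb HF Hc. set (X := Generator tau (cst 0) psi).
  assert (Hm := gradient_cst (- 1)).
  assert (Hvt := gradient_mult _ _ _ _ _ _ _ _ _ _ _ _ Hm (gradient_mult _ _ _ _ _ _ _ _ _ _ _ _ gradient_v Ha)).
  assert (Hot := gradient_mult _ _ _ _ _ _ _ _ _ _ _ _ Hm (gradient_mult _ _ _ _ _ _ _ _ _ _ _ _ gradient_om Ha)).
  assert (Hall : forall P : R -> R -> R -> R -> R -> Prop,
    (forall t r th v om, P t r th v om) -> on_lines P).
  { intros P HP. split5; apply filter_forall; auto. }
  assert (Er : on_lines (fun t r th v om =>
    cst (- 1) t r th v om * (v * tau t r th v om) = char_r X t r th v om)).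
  { apply Hall. intros. unfold char_r, X, cst. simpl. ring. }
  assert (Eth : on_lines (fun t r th v om =>
    psi t r th v om + cst (- 1) t r th v om * (om * tau t r th v om) = char_th X t r th v om)).
  { apply Hall. intros. unfold char_th, X, cst. simpl. ring. }
  assert (Hcr := gradient_ext _ _ _ _ _ _ _ Er Hvt).
  assert (Hcth := gradient_ext _ _ _ _ _ _ _ Eth (gradient_plus _ _ _ _ _ _ _ _ _ _ _ _ Hb Hot)).
  split; [eapply gradient_has_partials, Hcr |].
  split; [eapply gradient_has_partials, Hcth |].
  split; [eapply gradient_has_partials, HF |].
  unfold pr. rewrite (Dt_gradient _ _ _ _ _ _ HF), (Dt_gradient _ _ _ _ _ _ Hcr),
    (Dt_gradient _ _ _ _ _ _ Hcth).
  destruct (gradient_values _ _ _ _ _ _ HF) as (_ & -> & -> & -> & ->).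
  rewrite <- Hc. unfold Dt_of_gradient, char_r, char_th, X, cst. simpl. field. exact Hr.
Qed.

End PhaseSpace.

Lemma gradient_L (t r th v om : R) :
  gradient t r th v om fi_L 0 (2 * om * r) 0 0 (r ^ 2).
Proof.
  unfold fi_L. split5; auto_derive; auto; ring.
Qed.

Lemma gradient_E (U : R -> R) (ueq t r th v om : R) :
  smooth_potential U -> 0 < r ->
  gradient t r th v om (fi_E U ueq) 0 (om ^ 2 * r + Derive U r) 0 v (om * r ^ 2).
Proof.
  intros HU Hr. assert (HUr : ex_derive U r) by apply (HU 1%nat r Hr).
  unfold fi_E, fi_L. split5; auto_derive; repeat split; auto; try nra; try ring.
  - change (Derive (fun x => U x) r) with (Derive U r). field. lra.
  - field. lra.
Qed.

Lemma gradient_comp (U : R -> R) (ueq t r th v om : R) (D : region) (f : R -> R -> R -> R) :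
  smooth_potential U -> 0 < r -> open3 D -> CkOn 1 D f ->
  let L := fi_L t r th v om in let E := fi_E U ueq t r th v om in
  D r L E ->
  gradient t r th v om (fun t r th v om => f r (fi_L t r th v om) (fi_E U ueq t r th v om))
    0
    (D1 f r L E + D2 f r L E * (2 * om * r) + D3 f r L E * (om ^ 2 * r + Derive U r))
    0
    (D3 f r L E * v)
    (D2 f r L E * r ^ 2 + D3 f r L E * (om * r ^ 2)).
Proof.
  intros HU Hr HD Hf L E Hp.
  destruct (gradient_L t r th v om) as (L1 & L2 & L3 & L4 & L5).
  destruct (gradient_E U ueq t r th v om HU Hr) as (E1 & E2 & E3 & E4 & E5).
  assert (Id : is_derive (fun x => x) r 1) by exact (is_derive_id r).
  assert (C := fun a b c s a' b' c' Hs => is_derive_chain3 D f a b c s a' b' c' HD Hf Hs).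
  assert (K := fun s => is_derive_const_R r s).
  split5.
  - eapply is_derive_eq; [exact (C (fun _ => r) (fun x => fi_L x r th v om) (fun x => fi_E U ueq x r th v om)
      t _ _ _ Hp (K t) L1 E1) | ring].
  - eapply is_derive_eq;
      [exact (C (fun x => x) (fun x => fi_L t x th v om) (fun x => fi_E U ueq t x th v om)
      r _ _ _ Hp Id L2 E2) | unfold L, E; ring].
  - eapply is_derive_eq; [exact (C (fun _ => r) (fun x => fi_L t r x v om) (fun x => fi_E U ueq t r x v om)
      th _ _ _ Hp (K th) L3 E3) | ring].
  - eapply is_derive_eq;
      [exact (C (fun _ => r) (fun x => fi_L t r th x om) (fun x => fi_E U ueq t r th x om)
      v _ _ _ Hp (K v) L4 E4) | unfold L, E; ring].
  - eapply is_derive_eq;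
      [exact (C (fun _ => r) (fun x => fi_L t r th v x) (fun x => fi_E U ueq t r th v x)
      om _ _ _ Hp (K om) L5 E5) | unfold L, E; ring].
Qed.

Lemma open3_curve (D : region) (a b c : R -> R) (s0 : R) :
  open3 D -> D (a s0) (b s0) (c s0) -> continuous a s0 -> continuous b s0 -> continuous c s0 ->
  locally s0 (fun s => D (a s) (b s) (c s)).
Proof.
  intros HD Hp Ha Hb Hc. destruct (HD _ _ _ Hp) as [d Hd].
  generalize (filter_and _ _ (proj1 (filterlim_locally _ _) Ha d)
    (filter_and _ _ (proj1 (filterlim_locally _ _) Hb d) (proj1 (filterlim_locally _ _) Hc d))).
  apply filter_imp. intros s (H1 & H2 & H3). now apply Hd.
Qed.

Lemma sign_square (v : R) : v <> 0 -> sign v * sign v = 1 /\ v = sign v * sqrt (v ^ 2).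
Proof.
  intros Hv. destruct (Rdichotomy v 0 Hv) as [H | H].
  - rewrite sign_eq_m1 by exact H. replace (v ^ 2) with ((- v) ^ 2) by ring.
    rewrite sqrt_pow2 by lra. lra.
  - rewrite sign_eq_1 by exact H. rewrite sqrt_pow2 by lra. lra.
Qed.

Lemma locally_sign (v : R) : v <> 0 -> locally v (fun x => sign x = sign v).
Proof.
  intros Hv. destruct (Rdichotomy v 0 Hv) as [H | H].
  - generalize (open_lt 0 v H). apply filter_imp. intros x Hx. now rewrite !sign_eq_m1.
  - generalize (open_gt 0 v H). apply filter_imp. intros x Hx. now rewrite !sign_eq_1.
Qed.

(** * Theta, T and their parameter derivatives near a state *)

Section State.

Variables (U : R -> R) (ueq : R) (r0 : R -> R -> R) (V : R -> R -> R -> R) (t r th v om d : R).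
Hypotheses (HU : smooth_potential U) (Hr : 0 < r) (Hv : v <> 0).
Let L := fi_L t r th v om.
Let E := fi_E U ueq t r th v om.
Hypothesis HV : generates_Theta_T U ueq r0 V r L E d.
Let B := slab (r - d) (r + d) L E d.
Let sg := sign v.

Let HB : open3 B := open3_slab _ _ _ _ _.
Let Hcenter : B r L E := slab_center U ueq r0 V r L E d HV.
Let HV3 : CkOn 3 B V := proj1 (proj2 HV).
Let HV_2 : CkOn 2 B (D2 V) := CkOn_D2 2 B V HV3.
Let HV_3 : CkOn 2 B (D3 V) := CkOn_D3 2 B V HV3.

(** Asserted on the whole slab and not only at the state, because these parameter derivatives are
    components of generators and will be differentiated again. *)
Lemma Theta_T_is_derive (s x l e : R) : B x l e ->
  (forall a, is_derive (fun l => Theta_LE U ueq r0 s x a l e) l (s * D2 (D2 V) x l e)) /\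
  (forall a, is_derive (fun e => Theta_LE U ueq r0 s x a l e) e (s * D3 (D2 V) x l e)) /\
  (forall a, is_derive (fun l => T_LE U ueq r0 s a x l e) l (- s * D2 (D3 V) x l e)) /\
  (forall a, is_derive (fun e => T_LE U ueq r0 s a x l e) e (- s * D3 (D3 V) x l e)).
Proof.
  intros Hp. destruct (open3_lines B x l e HB Hp) as (_ & N2 & N3).
  assert (H := proj2 (proj2 HV)).
  assert (HTh : forall a l e, B x l e -> Theta_LE U ueq r0 s x a l e = a + s * D2 V x l e).
  { intros a l' e' Hq. destruct (H x l' e' Hq) as (_ & _ & _ & K). apply (K s). }
  assert (HT : forall a l e, B x l e -> T_LE U ueq r0 s a x l e = a + - s * D3 V x l e).
  { intros a l' e' Hq. destruct (H x l' e' Hq) as (_ & _ & _ & K). destruct (K s) as (_ & _ & _ & ->).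
    ring. }
  assert (Hadd : forall a k (f : R -> R) y f', is_derive f y f' ->
    is_derive (fun u => a + k * f u) y (k * f')).
  { intros a k f y f' Hf. apply (is_derive_eq _ _ (0 + k * f')); [|ring].
    apply is_derive_plus_R; [apply is_derive_const_R |]. now apply (is_derive_scal f). }
  split; [|split; [|split]]; intros a.
  - apply (is_derive_ext_loc (fun l => a + s * D2 V x l e)).
    + revert N2. apply filter_imp. intros u Hu. symmetry. now apply HTh.
    + apply Hadd, (CkOn_is_derive2 1 B (D2 V) HV_2), Hp.
  - apply (is_derive_ext_loc (fun e => a + s * D2 V x l e)).
    + revert N3. apply filter_imp. intros u Hu. symmetry. now apply HTh.
    + apply Hadd, (CkOn_is_derive3 1 B (D2 V) HV_2), Hp.
  - apply (is_derive_ext_loc (fun l => a + - s * D3 V x l e)).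
    + revert N2. apply filter_imp. intros u Hu. symmetry. now apply HT.
    + apply Hadd, (CkOn_is_derive2 1 B (D3 V) HV_3), Hp.
  - apply (is_derive_ext_loc (fun e => a + - s * D3 V x l e)).
    + revert N3. apply filter_imp. intros u Hu. symmetry. now apply HT.
    + apply Hadd, (CkOn_is_derive3 1 B (D3 V) HV_3), Hp.
Qed.

Lemma state_on_lines (P : R -> R -> R -> R -> R -> Prop) :
  (forall t r th v om, B r (fi_L t r th v om) (fi_E U ueq t r th v om) -> sign v = sg ->
    P t r th v om) ->
  on_lines t r th v om P.
Proof.
  intros HP.
  destruct (gradient_L t r th v om) as (L1 & L2 & L3 & L4 & L5).
  destruct (gradient_E U ueq t r th v om HU Hr) as (E1 & E2 & E3 & E4 & E5).
  assert (Hc : forall (f : R -> R) x l, is_derive f x l -> continuous f x).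
  { intros f x l Hf. apply (ex_derive_continuous f). now exists l. }
  assert (Kr : forall s, continuous (fun _ : R => r) s) by (intros s; apply continuous_const).
  split5.
  - generalize (open3_curve B (fun _ => r) (fun x => fi_L x r th v om)
      (fun x => fi_E U ueq x r th v om) t HB Hcenter (Kr t) (Hc _ _ _ L1) (Hc _ _ _ E1)).
    apply filter_imp. intros x Hx. now apply HP.
  - generalize (open3_curve B (fun x => x) (fun x => fi_L t x th v om)
      (fun x => fi_E U ueq t x th v om) r HB Hcenter (continuous_id r)
      (Hc _ _ _ L2) (Hc _ _ _ E2)).
    apply filter_imp. intros x Hx. now apply HP.
  - generalize (open3_curve B (fun _ => r) (fun x => fi_L t r x v om)
      (fun x => fi_E U ueq t r x v om) th HB Hcenter (Kr th) (Hc _ _ _ L3) (Hc _ _ _ E3)).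
    apply filter_imp. intros x Hx. now apply HP.
  - generalize (filter_and _ _ (locally_sign v Hv)
      (open3_curve B (fun _ => r) (fun x => fi_L t r th x om)
      (fun x => fi_E U ueq t r th x om) v HB Hcenter (Kr v) (Hc _ _ _ L4) (Hc _ _ _ E4))).
    apply filter_imp. intros x [Hs Hx]. now apply HP.
  - generalize (open3_curve B (fun _ => r) (fun x => fi_L t r th v x)
      (fun x => fi_E U ueq t r th v x) om HB Hcenter (Kr om) (Hc _ _ _ L5) (Hc _ _ _ E5)).
    apply filter_imp. intros x Hx. now apply HP.
Qed.

(** [kt], [kr], [kth], [kl], [ke] are the partial derivatives in the coordinates (t, r, theta, L,
    E); the body is the chain rule back to (t, r, theta, v, omega). *)
Definition radial_gradient (F : phase_fun) (kt kth kr kl ke : R) : Prop :=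
  gradient t r th v om F kt (kr + kl * (2 * om * r) + ke * (om ^ 2 * r + Derive U r)) kth
    (ke * v) (kl * r ^ 2 + ke * (om * r ^ 2)).

Lemma radial_gradient_affine (F : phase_fun) (g : phase_fun) (kt kth k : R) (f : R -> R -> R -> R) :
  CkOn 1 B f -> gradient t r th v om g kt 0 kth 0 0 ->
  (forall t r th v om, B r (fi_L t r th v om) (fi_E U ueq t r th v om) -> sign v = sg ->
    F t r th v om = g t r th v om + k * f r (fi_L t r th v om) (fi_E U ueq t r th v om)) ->
  radial_gradient F kt kth (k * D1 f r L E) (k * D2 f r L E) (k * D3 f r L E).
Proof.
  intros Hf Hg HF.
  assert (H := gradient_plus _ _ _ _ _ _ _ _ _ _ _ _ _ _ _ _ _ Hg
    (gradient_mult _ _ _ _ _ _ _ _ _ _ _ _ _ _ _ _ _ (gradient_cst t r th v om k)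
      (gradient_comp U ueq t r th v om B f HU Hr HB Hf Hcenter))).
  assert (Hlines : on_lines t r th v om (fun t r th v om =>
    g t r th v om + cst k t r th v om * f r (fi_L t r th v om) (fi_E U ueq t r th v om)
    = F t r th v om)).
  { apply state_on_lines. intros t' r' th' v' om' Hp Hs. symmetry. now apply HF. }
  assert (H' := gradient_ext _ _ _ _ _ _ _ _ _ _ _ _ Hlines H).
  unfold radial_gradient. unfold cst in H'. fold L E in H'.
  destruct H' as (K1 & K2 & K3 & K4 & K5).
  split5; (eapply is_derive_eq; [eassumption | ring]).
Qed.

(** The contributions of [kl] and [ke] cancel because L and E are first integrals. *)
Lemma Dt_radial_gradient (kt kth kr kl ke : R) :
  Dt_of_gradient r v om U kt (kr + kl * (2 * om * r) + ke * (om ^ 2 * r + Derive U r)) kth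
    (ke * v) (kl * r ^ 2 + ke * (om * r ^ 2)) = kt + v * kr + om * kth.
Proof. unfold Dt_of_gradient. field. lra. Qed.

Lemma radial_gradient_Theta :
  radial_gradient (fi_Theta U ueq r0) 0 1 (sg * D1 (D2 V) r L E) (sg * D2 (D2 V) r L E)
    (sg * D3 (D2 V) r L E).
Proof.
  apply (radial_gradient_affine _ (fun _ _ th _ _ => th)).
  - now apply CkOn_pred.
  - apply gradient_th.
  - intros t' r' th' v' om' Hp Hs. unfold fi_Theta. rewrite Hs.
    assert (H := proj2 (proj2 HV)). destruct (H _ _ _ Hp) as (_ & _ & _ & K). apply K.
Qed.

Lemma radial_gradient_T :
  radial_gradient (fi_T U ueq r0) 1 0 (- sg * D1 (D3 V) r L E) (- sg * D2 (D3 V) r L E)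
    (- sg * D3 (D3 V) r L E).
Proof.
  apply (radial_gradient_affine _ (fun t _ _ _ _ => t)).
  - now apply CkOn_pred.
  - apply gradient_t.
  - intros t' r' th' v' om' Hp Hs. unfold fi_T. rewrite Hs.
    assert (H := proj2 (proj2 HV)). destruct (H _ _ _ Hp) as (_ & _ & _ & K).
    destruct (K sg) as (_ & _ & _ & ->). ring.
Qed.

Lemma radial_gradient_pure (F : phase_fun) (k : R) (f : R -> R -> R -> R) :
  CkOn 1 B f ->
  (forall t r th v om, B r (fi_L t r th v om) (fi_E U ueq t r th v om) -> sign v = sg ->
    F t r th v om = k * f r (fi_L t r th v om) (fi_E U ueq t r th v om)) ->
  radial_gradient F 0 0 (k * D1 f r L E) (k * D2 f r L E) (k * D3 f r L E) /\
  F t r th v om = k * f r L E.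
Proof.
  intros Hf HF. split.
  - apply (radial_gradient_affine _ (cst 0)); [exact Hf | apply gradient_cst |].
    intros. unfold cst. rewrite Rplus_0_l. now apply HF.
  - now apply HF.
Qed.

End State.

(** * Canonical coordinates *)

Ltac point_symmetry Gtau Gpsi GF :=
  eapply pr_acts_of_gradient; [assumption | exact Gtau | exact Gpsi | exact GF |];
  unfold cst, Dt_of_gradient; field; assumption.

(** Once v is replaced by S or -S and om by l / r^2, each action is an identity between rational
    expressions in S, l, r and the second parameter derivatives of V, which are kept as atoms. *)
Ltac dynamical_symmetry Gtau Gpsi GF Vtau Vpsi :=
  eapply pr_acts_of_gradient; [assumption | exact Gtau | exact Gpsi | exact GF |];
  rewrite !Dt_radial_gradient by assumption; cbv beta; rewrite Vtau, Vpsi;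
  match goal with
  | Hcases : _ \/ _, Hl : ?om = _ / _ ^ 2 |- _ =>
      destruct Hcases as [[E1 E2] | [E1 E2]]; rewrite E1, E2, Hl; field; lra
  end.

Theorem theorem3 (U : R -> R) (req : Rbar) (ueq : R) (r0 : R -> R -> R)
    (t r th v om : R)
    (HU : smooth_potential U)
    (Hreq : equilibrium U req ueq)
    (Hr : 0 < r)
    (Hv : v <> 0)
    (Hr0 : base_point U ueq r0 t r th v om) :
  let L := fi_L in
  let E := fi_E U ueq in
  let Theta := fi_Theta U ueq r0 in
  let T := fi_T U ueq r0 in
  let XL := X_L in
  let XE := X_E in
  let XTheta := X_Theta U ueq r0 in
  let XT := X_T U ueq r0 in
  let acts X F c := pr_acts U X F c t r th v om in
  Theta_T_well_defined U ueq r0 t r th v om /\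
  (first_integral_at U L t r th v om /\ first_integral_at U E t r th v om /\
   first_integral_at U Theta t r th v om /\ first_integral_at U T t r th v om) /\
  (acts XL L 0 /\ acts XL E 0 /\ acts XL T 0 /\ acts XL Theta (- 1)) /\
  (acts XE L 0 /\ acts XE E 0 /\ acts XE Theta 0 /\ acts XE T 1) /\
  (acts XTheta E 0 /\ acts XTheta Theta 0 /\ acts XTheta T 0 /\ acts XTheta L 1) /\
  (acts XT L 0 /\ acts XT Theta 0 /\ acts XT T 0 /\ acts XT E (- 1)) /\
  functionally_independent L E Theta T t r th v om.
Proof.
  destruct (base_point_generates U ueq r0 t r th v om HU Hr Hv Hr0) as (V & d & HV).
  set (l := fi_L t r th v om) in *. set (e := fi_E U ueq t r th v om) in *.
  set (B := slab (r - d) (r + d) l e d).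
  assert (Hp : B r l e) by exact (slab_center U ueq r0 V r l e d HV).
  assert (HB : open3 B) by apply open3_slab.
  assert (HV3 : CkOn 3 B V) by apply HV.
  destruct (action_mixed_first U ueq r0 V r l e d HV r l e Hp) as [M2 M3].
  destruct (action_mixed_second U ueq r0 V r l e d HV r l e Hp) as (M22 & M32 & M23 & M33).
  assert (Hsym := Schwarz23 B V HB (CkOn_pred _ _ _ HV3) r l e Hp).
  assert (HS : sqrt (radial_sq U ueq r (l ^ 2) e) = sqrt (v ^ 2)).
  { f_equal. now apply radial_sq_state. }
  rewrite HS in *. clear HS.
  destruct (sign_square v Hv) as [Hsg HvS].
  assert (HSpos : 0 < sqrt (v ^ 2)) by (apply sqrt_lt_R0; nra).
  assert (HlE : l = om * r ^ 2) by reflexivity.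
  set (S := sqrt (v ^ 2)) in *. set (sg := sign v) in *.
  assert (GL := gradient_L t r th v om).
  assert (GE := gradient_E U ueq t r th v om HU Hr).
  assert (GTh := radial_gradient_Theta U ueq r0 V t r th v om d HU Hr Hv HV).
  assert (GT := radial_gradient_T U ueq r0 V t r th v om d HU Hr Hv HV).
  assert (C22 : CkOn 1 B (D2 (D2 V))) by now apply CkOn_D2, CkOn_D2.
  assert (C32 : CkOn 1 B (D3 (D2 V))) by now apply CkOn_D3, CkOn_D2.
  assert (C23 : CkOn 1 B (D2 (D3 V))) by now apply CkOn_D2, CkOn_D3.
  assert (C33 : CkOn 1 B (D3 (D3 V))) by now apply CkOn_D3, CkOn_D3.
  destruct (radial_gradient_pure U ueq r0 V t r th v om d HU Hr Hv HV
    (Theta_E U ueq r0) sg (D3 (D2 V)) C32) as [GThE VThE].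
  { intros t' r' th' v' om' Hq Hs. unfold Theta_E. rewrite Hs. apply is_derive_unique.
    apply (Theta_T_is_derive U ueq r0 V t r th v om d HV sg r' _ _ Hq). }
  destruct (radial_gradient_pure U ueq r0 V t r th v om d HU Hr Hv HV
    (fun t r th v om => - Theta_L U ueq r0 t r th v om) (- sg) (D2 (D2 V)) C22) as [GThL VThL].
  { intros t' r' th' v' om' Hq Hs. unfold Theta_L. rewrite Hs, Ropp_mult_distr_l_reverse. f_equal.
    apply is_derive_unique.
    apply (Theta_T_is_derive U ueq r0 V t r th v om d HV sg r' _ _ Hq). }
  destruct (radial_gradient_pure U ueq r0 V t r th v om d HU Hr Hv HV
    (T_E U ueq r0) (- sg) (D3 (D3 V)) C33) as [GTE VTE].
  { intros t' r' th' v' om' Hq Hs. unfold T_E. rewrite Hs. apply is_derive_unique.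
    apply (Theta_T_is_derive U ueq r0 V t r th v om d HV sg r' _ _ Hq). }
  destruct (radial_gradient_pure U ueq r0 V t r th v om d HU Hr Hv HV
    (fun t r th v om => - T_L U ueq r0 t r th v om) sg (D2 (D3 V)) C23) as [GTL VTL].
  { intros t' r' th' v' om' Hq Hs. unfold T_L. rewrite Hs.
    transitivity (- (- sg * D2 (D3 V) r' (fi_L t' r' th' v' om') (fi_E U ueq t' r' th' v' om')));
      [f_equal | ring].
    apply is_derive_unique.
    apply (Theta_T_is_derive U ueq r0 V t r th v om d HV sg r' _ _ Hq). }
  unfold radial_gradient in *. fold l e sg in GTh, GT, GThE, GThL, GTE, GTL, VThE, VThL, VTE, VTL.
  cbv beta in VThL, VTL.
  rewrite M2 in GTh. rewrite M3 in GT. rewrite M32 in GThE. rewrite M22 in GThL.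
  rewrite M33 in GTE. rewrite M23 in GTL.
  (* Symmetry of the mixed derivative in (L, E) amounts to Theta_E + T_L = 0, the value that pr
     X_Theta takes on T and, up to sign, that pr X_T takes on Theta. *)
  rewrite Hsym in GT, VTL.
  assert (G0 := gradient_cst t r th v om 0).
  assert (Gm1 := gradient_cst t r th v om (- 1)).
  assert (G1 := gradient_cst t r th v om 1).
  assert (Hwd : Theta_T_well_defined U ueq r0 t r th v om).
  { assert (H := proj2 (proj2 HV) r l e Hp). destruct H as (_ & _ & _ & K).
    destruct (K sg) as (K1 & K2 & _).
    destruct (Theta_T_is_derive U ueq r0 V t r th v om d HV sg r l e Hp) as (D1' & D2' & D3' & D4').
    split; [exact K1 | split; [exact K2 |]].
    split; [|split; [|split]]; eexists; [apply D1' | apply D2' | apply D3' | apply D4']. }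
  split; [exact Hwd |]. clear Hwd.
  assert (Hr' : r <> 0) by lra.
  (* From here on S is an arbitrary positive number with v = sgn(v) S, which keeps square roots out
     of the algebra. *)
  clearbody S.
  assert (Hcases : sg = 1 /\ v = S \/ sg = - 1 /\ v = - S).
  { assert (H : (sg - 1) * (sg + 1) = 0) by lra. apply Rmult_integral in H.
    destruct H as [H | H]; [left | right]; split; try lra; rewrite HvS; nra. }
  assert (Hl : om = l / r ^ 2) by (rewrite HlE; field; lra).
  split; [split; [|split; [|split]] |].
  { eapply first_integral_of_gradient; [exact GL |]. unfold Dt_of_gradient. field. lra. }
  { eapply first_integral_of_gradient; [exact GE |]. unfold Dt_of_gradient. field. lra. }
  { eapply first_integral_of_gradient; [exact GTh |]. rewrite Dt_radial_gradient by exact Hr.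
    rewrite Hl. destruct Hcases as [[E1 E2] | [E1 E2]]; rewrite E1, E2; field; lra. }
  { eapply first_integral_of_gradient; [exact GT |]. rewrite Dt_radial_gradient by exact Hr.
    destruct Hcases as [[E1 E2] | [E1 E2]]; rewrite E1, E2; field; lra. }
  split; [split; [|split; [|split]] |].
  { point_symmetry G0 Gm1 GL. }
  { point_symmetry G0 Gm1 GE. }
  { point_symmetry G0 Gm1 GT. }
  { point_symmetry G0 Gm1 GTh. }
  split; [split; [|split; [|split]] |].
  { point_symmetry G1 G0 GL. }
  { point_symmetry G1 G0 GE. }
  { point_symmetry G1 G0 GTh. }
  { point_symmetry G1 G0 GT. }
  split; [split; [|split; [|split]] |].
  { dynamical_symmetry GThE GThL GE VThE VThL. }
  { dynamical_symmetry GThE GThL GTh VThE VThL. }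
  { dynamical_symmetry GThE GThL GT VThE VThL. }
  { dynamical_symmetry GThE GThL GL VThE VThL. }
  split; [split; [|split; [|split]] |].
  { dynamical_symmetry GTE GTL GL VTE VTL. }
  { dynamical_symmetry GTE GTL GTh VTE VTL. }
  { dynamical_symmetry GTE GTL GT VTE VTL. }
  { dynamical_symmetry GTE GTL GE VTE VTL. }
  (* The system is triangular: only T depends explicitly on t and only Theta on theta, giving c4 =
     c3 = 0. Then the v-equation reads c2 v = 0, and the omega-equation reduces to c1 r^2 = 0. *)
  intros c1 c2 c3 c4 comb H1 H2 H3 H4 H5. unfold comb in *. clear comb.
  destruct (gradient_values _ _ _ _ _ _ _ _ _ _ _ GL) as (L1 & _ & L3 & L4 & L5).
  destruct (gradient_values _ _ _ _ _ _ _ _ _ _ _ GE) as (E1 & _ & E3 & E4 & E5).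
  destruct (gradient_values _ _ _ _ _ _ _ _ _ _ _ GTh) as (A1 & _ & A3 & A4 & A5).
  destruct (gradient_values _ _ _ _ _ _ _ _ _ _ _ GT) as (B1 & _ & B3 & B4 & B5).
  rewrite L1, E1, A1, B1 in H1. rewrite L3, E3, A3, B3 in H3.
  rewrite L4, E4, A4, B4 in H4. rewrite L5, E5, A5, B5 in H5.
  assert (Hc4 : c4 = 0) by lra. assert (Hc3 : c3 = 0) by lra.
  rewrite Hc3, Hc4 in H4, H5.
  assert (Hc2 : c2 = 0) by (apply (Rmult_eq_reg_r v); lra).
  rewrite Hc2 in H5.
  assert (Hc1 : c1 = 0) by (apply (Rmult_eq_reg_r (r ^ 2)); [lra | now apply pow_nonzero]).
  tauto.
Qed.
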